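(* There exists a planar $3$-tree whose queue number is at least $4$. In particular, there exist planar graphs with queue number at least $4$.
   Context: A planar $3$-tree is a triangulated plane graph $G$ with $n\ge 3$ vertices such that either $n=3$ and $G$ is a $3$-cycle, or $n>3$ and $G$ has a vertex whose deletion yields a planar $3$-tree with $n-1$ vertices. A $k$-queue layout of a graph $G$ consists of a linear order $\prec$ of the vertices of $G$ and a partition of the edges of $G$ into $k$ sets (queues) such that no two independent edges (edges sharing no endvertex) of the same queue are nested. Two edges $(s_1,t_1)$ and $(s_2,t_2)$ with $s_1\prec t_1$, $s_2\prec t_2$ are nested if $s_1\prec s_2\prec t_2\prec t_1$ or $s_2\prec s_1\prec t_1\prec t_2$. The queue number of $G$ is the minimum $k$ such that $G$ admits a $k$-queue layout. *)

(* Defs.v *)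
From mathcomp Require Import all_boot.
Set Implicit Arguments. Unset Strict Implicit. Unset Printing Implicit Defensive.

(* A graph on vertex set {0,...,n-1} is given by n and a symmetric edge
   relation E : rel nat.  A plane triangulation is tracked combinatorially
   by the list of its (triangular) faces, each face a triple of vertices. *)

Definition stack_edges (E : rel nat) (n x y z : nat) : rel nat :=
  fun u w => [|| E u w,
                (u == n) && (w \in [:: x; y; z]) |
                (w == n) && (u \in [:: x; y; z])].

Definition stack_faces (F : seq (nat * nat * nat)) (n x y z : nat)
  : seq (nat * nat * nat) :=
  (n, y, z) :: (x, n, z) :: (x, y, n) :: rem (x, y, z) F.

(* Planar 3-trees: the 3-cycle (with its two faces, inner and outer), and
   every graph obtained from a planar 3-tree with n-1 vertices by inserting a
   new (degree-3) vertex into one of its faces and joining it to the three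
   corners of that face. *)
Inductive planar3tree : nat -> rel nat -> seq (nat * nat * nat) -> Prop :=
| p3t_base :
    planar3tree 3
      (fun u w => (u != w) && (u < 3) && (w < 3))
      [:: (0, 1, 2); (0, 1, 2)]
| p3t_step n E F x y z :
    planar3tree n E F -> (x, y, z) \in F ->
    planar3tree n.+1 (stack_edges E n x y z) (stack_faces F n x y z).

Definition is_planar3tree (n : nat) (E : rel nat) : Prop :=
  exists F, planar3tree n E F.

Definition nested (pos : nat -> nat) (s1 t1 s2 t2 : nat) : Prop :=
  (pos s1 < pos s2 < pos t2) && (pos t2 < pos t1).

(* A k-queue layout of the graph (n, E): a linear order of the vertices
   (injective position map pos on {0..n-1}) and an assignment c of each edge
   to one of k queues (c u w = c w u), such that no two independent edges of
   the same queue are nested. *)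
Definition queue_layout (n : nat) (E : rel nat) (k : nat) : Prop :=
  exists (pos : nat -> nat) (c : nat -> nat -> nat),
    (forall u v, u < n -> v < n -> pos u = pos v -> u = v) /\
    (forall u w, u < n -> w < n -> E u w -> c u w = c w u /\ c u w < k) /\
    (forall s1 t1 s2 t2,
        s1 < n -> t1 < n -> s2 < n -> t2 < n ->
        E s1 t1 -> E s2 t2 ->
        s1 != s2 -> s1 != t2 -> t1 != s2 -> t1 != t2 ->
        c s1 t1 = c s2 t2 ->
        ~ nested pos s1 t1 s2 t2).

Definition queue_number_ge (n : nat) (E : rel nat) (q : nat) : Prop :=
  forall k, queue_layout n E k -> q <= k.

(* Main.v *)
Require Import Defs.
From mathcomp Require Import all_boot zify.

(** Play a game against a hypothetical 3-queue layout.  Suppose that every edge uv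
    carries a long fan: a path x_0 x_1 x_2 ... of common neighbours of u and v, all
    of whose edges ux_i, vx_i, x_i x_(i+1) again carry fans, down to depth 4; a planar
    3-tree with this property is obtained by stacking into faces.  After some vertices
    have been looked at, pick one of their edges uv.  By pigeonhole, five disjoint
    pairs (p_i, q_i) of consecutive fan vertices have the same colours and lie in the
    same gaps between the vertices seen so far.  As the edges p_i q_i have one colour
    and hence do not nest, three of these pairs occur in the order p1 q1 p2 q2 p3 q3
    or p1 p2 p3 q1 q2 q3.  So only finitely many responses of the layout must be
    considered, and a computer search found that after at most four fans no response
    is free of monochromatic nested edges. *)

(** Only one inclusion matters: the configuration that occurs in a given layout must be listed by
    [responses]. The list may also contain states that no layout realizes, so each filter only has
    to be justified by exhibiting two nested edges of one colour. The search result is a mere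
    certificate: it names the edges to look at, and [wins] recomputes all responses. Several
    vertices of the same type in one gap are what gives the search its force. For instance, two fan
    vertices in one gap outside the interval spanned by [u] and [v] already force the edges to [u]
    and to [v] to differ in colour. Each fan adds six ranks and uses up one level of richness, so
    four fans lead from 2 ranks to at most 26. This bounds the number of gaps, hence the number of
    types of a pair, hence the fan length [N] that the pigeonhole argument requires. Fan vertices
    seen earlier spoil at most one pair each. *)

Set Implicit Arguments.
Unset Strict Implicit.
Unset Printing Implicit Defensive.

(** * The game *)

(* [(n, es)] describes a partial layout of n vertices, each named by its rank in the
   order; [(a, b, k)] in [es] is an edge of colour k between ranks a < b. *)
Definition state := (nat * seq (nat * nat * nat))%type.

Definition chord (a b : nat) := if a < b then (a, b) else (b, a).

Definition nests (e f : nat * nat) :=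
  (e.1 < f.1) && (f.2 < e.2) || (f.1 < e.1) && (e.2 < f.2).

Definition free (es : seq (nat * nat * nat)) e :=
  [seq k <- iota 0 3 | ~~ has (fun f => (f.2 == k) && nests e f.1) es].

(** A pair of a list of edges and a colour is one monochromatic group. Applied to a group and
    itself, the test excludes nesting inside the group. *)
Definition compatible (g h : seq (nat * nat) * nat) :=
  (g.2 == h.2) ==> ~~ has (fun e => has (nests e) h.1) g.1.

(* Six vertices y_0 < ... < y_5 are inserted, y_0, y_1, y_2 into gap z1 and y_3, y_4, y_5
   into gap z2 >= z1, where gap z is the place just before rank z.  The old rank r becomes
   [shift z1 z2 r], and y_j gets rank [fan_rank z1 z2 j]. *)
Definition shift (z1 z2 r : nat) := r + (z1 <= r) * 3 + (z2 <= r) * 3.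

Definition fan_rank (z1 z2 j : nat) := (if j < 3 then z1 else z2) + j.

Arguments shift : simpl never.
Arguments fan_rank : simpl never.

(* The indices (i, j) with (p, q) = (y_i, y_j); the first pattern requires z1 = z2. *)
Definition fan_pairs (b : bool) :=
  if b then [:: (0, 1); (2, 3); (4, 5)] else [:: (0, 3); (1, 4); (2, 5)].

(** [c] holds the colours of the edges from the vertices p_i to [u] and to [v], and [d] those from
    the vertices q_i. *)
Definition spokes u v z1 z2 b (c d : nat * nat) :=
  let y := fan_rank z1 z2 in
  let u' := shift z1 z2 u in let v' := shift z1 z2 v in
  [:: ([seq chord u' (y i.1) | i <- fan_pairs b], c.1);
      ([seq chord v' (y i.1) | i <- fan_pairs b], c.2);
      ([seq chord u' (y i.2) | i <- fan_pairs b], d.1);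
      ([seq chord v' (y i.2) | i <- fan_pairs b], d.2)].

Definition rungs z1 z2 b : seq (nat * nat) :=
  [seq (fan_rank z1 z2 i.1, fan_rank z1 z2 i.2) | i <- fan_pairs b].

Definition paint (g : seq (nat * nat) * nat) := [seq (e, g.2) | e <- g.1].

Definition expand (s : state) u v z1 z2 b c d k : state :=
  (s.1 + 6,
   flatten (map paint ((rungs z1 z2 b, k) :: spokes u v z1 z2 b c d)) ++
   [seq (shift z1 z2 e.1.1, shift z1 z2 e.1.2, e.2) | e <- s.2]).

(* In the prefilter, ranks r are doubled to 2r+1 so that gap z can be placed at 2z.
   Several fan vertices x in one gap outside [u, v] force ux and vx to differ in colour. *)
Definition gap_colours es u v z : seq (nat * nat) :=
  [seq c <- [seq (i, j) | i <- free es (chord u.*2.+1 z.*2), j <- free es (chord v.*2.+1 z.*2)]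
  | (u < z <= v) || (c.1 != c.2)].

(** Old edges are compared with new ones through [free] in doubled coordinates, before any new state
    is built; new edges are compared with each other through [compatible]. The pattern [true] needs
    a single gap: with two different gaps, all p_i precede all q_i. *)
Definition responses (s : state) u v : seq state :=
  let es := [seq (e.1.1.*2.+1, e.1.2.*2.+1, e.2) | e <- s.2] in
  let gaps := [seq g <- [seq (z, gap_colours es u v z) | z <- iota 0 s.1.+1]
              | ~~ nilp g.2] in
  flatten [seq
    (if h.1 < g.1 then [::] else
     let ks := free es (g.1.*2, h.1.*2) in
     flatten [seq flatten [seq flatten [seq
       (let gs := spokes u v g.1 h.1 b c d in
        if pairwise compatible gs && all (fun x => compatible x x) gs then
          [seq expand s u v g.1 h.1 b c d k
          | k <- ks & all (compatible (rungs g.1 h.1 b, k)) ((rungs g.1 h.1 b, k) :: gs)]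
        else [::])
       | d <- h.2] | c <- g.2]
       | b <- if g.1 == h.1 then [:: true; false] else [:: false]])
  | g <- gaps, h <- gaps].

(* [Fan u v ts]: look at a fan over the edge uv, and answer the i-th response by the i-th
   strategy in [ts]. *)
Inductive strategy := Fan of nat & nat & seq strategy.

(** The game ends where [responses] is empty: a leaf [Fan u v [::]] passes only if no response
    survives. The fuel [d] is the number of fans still allowed. *)
Fixpoint wins (d : nat) (t : strategy) (s : state) : bool :=
  if d is d'.+1 then
    let: Fan u v ts := t in
    has (fun e => e.1 == (u, v)) s.2 && all2 (wins d') ts (responses s u v)
  else false.

(** * Planar 3-trees all of whose edges carry fans *)

(** The fan has [2N + 1] vertices, enough for the [N] disjoint pairs [x_(2i)], [x_(2i+1)]. Vertices
    are numbered in order of creation, so increasing labels are a convenient way to record that fan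
    vertices are distinct. *)
Fixpoint rich (G : rel nat) (N d u v : nat) : Prop :=
  G u v /\
  if d is d'.+1 then
    exists x : nat -> nat,
      (forall i, i < N.*2 -> x i < x i.+1) /\
      (forall i, i < N.*2 ->
        [/\ rich G N d' u (x i), rich G N d' v (x i) & rich G N d' (x i) (x i.+1)])
  else True.

Lemma rich_edge G N d u v : rich G N d u v -> G u v.
Proof. by case: d => [|d] []. Qed.

Lemma rich_mono (G G' : rel nat) N d u v :
  subrel G G' -> rich G N d u v -> rich G' N d u v.
Proof.
move=> sGG'; elim: d u v => [|d IHd] u v /= [/sGG' -> // [x [x_mono x_rich]]].
split=> //; exists x; split=> // i /x_rich[? ? ?].
by split; apply: IHd.
Qed.

Lemma rich_sym (G : rel nat) N d u v :
  symmetric G -> rich G N d u v -> rich G N d v u.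
Proof.
move=> symG; case: d => [|d] /= [Guv]; first by rewrite symG.
case=> x [x_mono x_rich]; rewrite symG; split=> //; exists x; split=> //.
by move=> i /x_rich[].
Qed.

Definition adjacency (n : nat) (E : rel nat) : rel nat :=
  fun u v => [&& u < n, v < n & E u v].

Lemma adjacency_mono n n' (E E' : rel nat) :
  n <= n' -> subrel E E' -> subrel (adjacency n E) (adjacency n' E').
Proof.
move=> le_nn' sEE' u v /and3P[u_lt v_lt /sEE' Euv].
by rewrite /adjacency Euv !(leq_trans _ le_nn').
Qed.

Lemma planar3tree_sym n E F : planar3tree n E F -> symmetric E.
Proof.
elim=> [|{}n {}E {}F x y z _ symE _] u v.
  by rewrite eq_sym -!andbA; congr (_ && _); rewrite andbC.
by rewrite /stack_edges symE; congr (_ || _); rewrite orbC.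
Qed.

Lemma adjacency_sym n E F : planar3tree n E F -> symmetric (adjacency n E).
Proof.
by move=> /planar3tree_sym symE u v; rewrite /adjacency symE andbCA.
Qed.

(** * Faces up to the order of their corners, and filling them with fans *)

Definition corners (f : nat * nat * nat) := [:: f.1.1; f.1.2; f.2].

(** The order of the corners in a face depends on the history of the stacking. Sorted corners
    identify a face regardless of it, and [perm_eq] does the same for the list of faces. *)
Definition face_keys (F : seq (nat * nat * nat)) :=
  [seq sort leq (corners f) | f <- F].

Definition split_keys (n : nat) (s : seq nat) :=
  [seq sort leq (n :: rem t s) | t <- s].

Lemma sort_leqP (s t : seq nat) : reflect (sort leq s = sort leq t) (perm_eq s t).
Proof. by apply: perm_sortP; [apply: leq_total | apply: leq_trans | apply: anti_leq]. Qed.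

Lemma perm_front (T : eqType) (x : T) s t u :
  perm_eq s (t ++ x :: u) -> perm_eq s (x :: t ++ u).
Proof. by move=> st; rewrite (permPl st) perm_catC /= perm_cons perm_catC. Qed.

Lemma perm_rem (T : eqType) (r : T) (s t : seq T) :
  perm_eq s t -> perm_eq (rem r s) (rem r t).
Proof.
move=> st; have [rs|rNs] := boolP (r \in s); last first.
  by rewrite !rem_id // -(perm_mem st).
rewrite -(perm_cons r) -(permPl (perm_to_rem rs)) (permPl st).
by apply: perm_to_rem; rewrite -(perm_mem st).
Qed.

Lemma perm_split_keys n s t : perm_eq s t -> perm_eq (split_keys n s) (split_keys n t).
Proof.
move=> st; rewrite /split_keys.
have e r : sort leq (n :: rem r s) = sort leq (n :: rem r t).
  by apply/sort_leqP; rewrite perm_cons perm_rem.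
by rewrite (eq_map e) perm_map.
Qed.

(** If two corners coincide, [rem] may delete another occurrence than intended, but the remaining
    multiset is the same; hence the case distinctions. *)
Lemma split_keys3 n x y z :
  split_keys n [:: x; y; z] =
  [:: sort leq [:: n; y; z]; sort leq [:: x; n; z]; sort leq [:: x; y; n]].
Proof.
rewrite /split_keys /= eqxx.
congr [:: _; _; _]; apply/sort_leqP; apply/permP => a /=.
  by have [->|xy] /= := eqVneq x y; rewrite ?eqxx /=; lia.
have [->|xz] := eqVneq x z; have [->|yz] /= := eqVneq y z; rewrite ?eqxx /=; lia.
Qed.

Lemma stack_face n E F x y z R :
  planar3tree n E F -> perm_eq (face_keys F) (sort leq [:: x; y; z] :: R) ->
  exists E' F',
    [/\ planar3tree n.+1 E' F', subrel E E', {in [:: x; y; z], forall w, E' n w} &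
        perm_eq (face_keys F')
          [:: sort leq [:: n; y; z], sort leq [:: x; n; z], sort leq [:: x; y; n] & R]].
Proof.
move=> nEF permF.
have /mapP[[[x' y'] z'] fF xyz] : sort leq [:: x; y; z] \in face_keys F.
  by rewrite (perm_mem permF) mem_head.
have xyzP : perm_eq [:: x; y; z] [:: x'; y'; z'] by apply/sort_leqP.
exists (stack_edges E n x' y' z'), (stack_faces F n x' y' z').
split; first exact: p3t_step.
- by move=> u v Euv; rewrite /stack_edges Euv.
- by move=> w w_xyz; rewrite /stack_edges eqxx -(perm_mem xyzP) w_xyz orbT.
have permR : perm_eq (face_keys (rem (x', y', z') F)) R.
  rewrite -(perm_cons (sort leq [:: x; y; z])) -(permPr permF) {1}xyz perm_sym.
  exact: (perm_map (fun f => sort leq (corners f)) (perm_to_rem fF)).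
rewrite -[face_keys _]/([:: _; _; _] ++ face_keys (rem (x', y', z') F)).
rewrite -[perm_eq _ _]/(perm_eq _ ([:: _; _; _] ++ R)).
by apply: perm_cat => //; rewrite -!split_keys3 perm_split_keys // perm_sym.
Qed.

(** All stacking happens inside the chosen face: the other faces [R] survive, so that faces can be
    filled one after the other. *)
Definition fillable N d := forall n E F x y z R,
  planar3tree n E F -> perm_eq (face_keys F) (sort leq [:: x; y; z] :: R) ->
  let G := adjacency n E in G x y -> G x z -> G y z ->
  exists n' E' F' R',
    [/\ planar3tree n' E' F', perm_eq (face_keys F') (R' ++ R), n <= n', subrel E E' &
        let G' := adjacency n' E' in
        [/\ rich G' N d x y, rich G' N d x z & rich G' N d y z]].

(** The fan over [a b] grows inside one face: each new vertex is stacked into the face [a], [b],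
    [x k] and becomes the next vertex of the path. The edges at the last vertex are made rich only
    in the next step, whence the bound [i < k]. *)
Lemma fan_path N d k n E F a b w R :
  fillable N d ->
  planar3tree n E F -> perm_eq (face_keys F) (sort leq [:: a; b; w] :: R) ->
  let G := adjacency n E in G a b -> G a w -> G b w ->
  exists n' E' F' R' x,
    let G' := adjacency n' E' in
    [/\ planar3tree n' E' F', perm_eq (face_keys F') (sort leq [:: a; b; x k] :: R' ++ R),
        n <= n' /\ subrel E E',
        G' a (x k) /\ G' b (x k) &
        forall i, i < k -> x i < x i.+1 /\
          [/\ rich G' N d a (x i), rich G' N d b (x i) & rich G' N d (x i) (x i.+1)]].
Proof.
move=> fillN nEF permF G Gab Gaw Gbw.
elim: k => [|k [n1 [E1 [F1 [R1 [x [nEF1 permF1 [le_n1 sE1] [Gak Gbk] x_rich]]]]]]].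
  by exists n, E, F, [::], (fun=> w); do !split.
have [E2 [F2 [nEF2 sE2 E2n permF2]]] := stack_face nEF1 permF1.
have sG1 := adjacency_mono (leqnSn n1) sE2.
have lt_k : x k < n1 by case/and3P: Gak.
have Gab1 := adjacency_mono le_n1 sE1 Gab.
have G2n v : v < n1 -> v \in [:: a; b; x k] -> adjacency n1.+1 E2 n1 v.
  by move=> vn vP; rewrite /adjacency ltnSn E2n // (leqW vn).
have symG2 := adjacency_sym nEF2.
have G2na : adjacency n1.+1 E2 n1 a.
  by apply: G2n; rewrite ?mem_head //; case/and3P: Gab1.
have G2nb : adjacency n1.+1 E2 n1 b.
  by apply: G2n; rewrite ?inE ?eqxx ?orbT //; case/and3P: Gab1.
have G2nk : adjacency n1.+1 E2 n1 (x k).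
  by apply: G2n; rewrite ?inE ?eqxx ?orbT //; case/and3P: Gak.
(* Filling the face [n1], [b], [x k] makes the edges from [x k] to [b] and to [n1] rich; filling
   [a], [n1], [x k] afterwards does so for the edge from [x k] to [a]. The face [a], [b], [n1] stays
   empty for the next vertex. *)
have [n3 [E3 [F3 [R3 [nEF3 permF3 le_n3 sE3 [rich_nb rich_nk rich_bk]]]]]] :=
  fillN _ _ _ _ _ _ _ nEF2 permF2 G2nb G2nk (sG1 _ _ Gbk).
have sG3 := adjacency_mono le_n3 sE3.
have {}permF3 : perm_eq (face_keys F3)
    (sort leq [:: a; n1; x k] :: (R3 ++ sort leq [:: a; b; n1] :: (R1 ++ R))).
  exact: perm_front permF3.
have [n4 [E4 [F4 [R4 [nEF4 permF4 le_n4 sE4 [rich_an rich_ak _]]]]]] :=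
  fillN _ _ _ _ _ _ _ nEF3 permF3 (sG3 _ _ (etrans (symG2 _ _) G2na))
    (sG3 _ _ (sG1 _ _ Gak)) (sG3 _ _ G2nk).
have sG4 := adjacency_mono le_n4 sE4.
have sG34 : subrel (adjacency n1.+1 E2) (adjacency n4 E4).
  by move=> u v /sG3/sG4.
have sG14 : subrel (adjacency n1 E1) (adjacency n4 E4) by move=> u v /sG1/sG34.
have symG4 := adjacency_sym nEF4.
exists n4, E4, F4, (R4 ++ R3 ++ R1), (fun i => if i <= k then x i else n1).
rewrite ltnn; split=> //.
- by rewrite (catA R4) -(catA _ R1); apply: perm_front; rewrite -catA.
- split; first exact: leq_trans le_n1 (ltnW (leq_trans le_n3 le_n4)).
  by move=> u v /sE1/sE2/sE3/sE4.
- by split; rewrite symG4; apply: sG34.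
move=> i; rewrite ltnS => le_ik; rewrite /= le_ik; have [lt_ik|ge_ik] := ltnP i k.
  have [? [? ? ?]] := x_rich _ lt_ik.
  by split=> //; split; apply: rich_mono sG14 _.
have -> : i = k by apply/eqP; rewrite eqn_leq le_ik.
split=> //; split.
- exact: rich_ak.
- exact: rich_mono sG4 rich_bk.
by apply: rich_sym symG4 _; apply: rich_mono sG4 rich_nk.
Qed.

Lemma fill_edge N d n E F a b w R :
  fillable N d ->
  planar3tree n E F -> perm_eq (face_keys F) (sort leq [:: a; b; w] :: R) ->
  let G := adjacency n E in G a b -> G a w -> G b w ->
  exists n' E' F' R',
    [/\ planar3tree n' E' F', perm_eq (face_keys F') (R' ++ R), n <= n', subrel E E' &
        rich (adjacency n' E') N d.+1 a b].
Proof.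
move=> fillN nEF permF G Gab Gaw Gbw.
have [n' [E' [F' [R' [x [nEF' permF' [le_n sE] _ x_rich]]]]]] :=
  fan_path N.*2 fillN nEF permF Gab Gaw Gbw.
exists n', E', F', (sort leq [:: a; b; x N.*2] :: R'); split=> //; split.
  exact: adjacency_mono Gab.
by exists x; split=> i /x_rich[].
Qed.

(** A vertex stacked into the face separates its three sides: each new face contains exactly one of
    them, and there [fill_edge] builds the fan over that side. *)
Lemma fillableP N d : fillable N d.
Proof.
elim: d => [|d IHd] n E F x y z R nEF permF G Gxy Gxz Gyz.
  exists n, E, F, [:: sort leq [:: x; y; z]]; split=> //.
have [E1 [F1 [nEF1 sE1 E1n permF1]]] := stack_face nEF permF.
have sG1 := adjacency_mono (leqnSn n) sE1.
have G1n v : v < n -> v \in [:: x; y; z] -> adjacency n.+1 E1 n v.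
  by move=> vn vP; rewrite /adjacency ltnSn E1n // (leqW vn).
have symG1 := adjacency_sym nEF1.
have G1nx : adjacency n.+1 E1 n x by apply: G1n; rewrite ?mem_head //; case/and3P: Gxy.
have G1ny : adjacency n.+1 E1 n y.
  by apply: G1n; rewrite ?inE ?eqxx ?orbT //; case/and3P: Gxy.
have G1nz : adjacency n.+1 E1 n z.
  by apply: G1n; rewrite ?inE ?eqxx ?orbT //; case/and3P: Gxz.
have keyE s t : perm_eq s t -> sort leq s = sort leq t by move=> ?; apply/sort_leqP.
have k1 : sort leq [:: n; y; z] = sort leq [:: y; z; n].
  by apply: keyE; rewrite -(perm_rot 1).
have k2 : sort leq [:: x; n; z] = sort leq [:: x; z; n].
  by apply: keyE; rewrite perm_cons -(perm_rot 1).
rewrite k1 k2 in permF1.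
have [n2 [E2 [F2 [R2 [nEF2 permF2 le_n2 sE2 rich_yz]]]]] :=
  fill_edge IHd nEF1 permF1 (sG1 _ _ Gyz) (etrans (symG1 _ _) G1ny)
    (etrans (symG1 _ _) G1nz).
have sG2 := adjacency_mono le_n2 sE2.
have {}permF2 : perm_eq (face_keys F2)
    (sort leq [:: x; z; n] :: (R2 ++ sort leq [:: x; y; n] :: R)).
  exact: perm_front permF2.
have [n3 [E3 [F3 [R3 [nEF3 permF3 le_n3 sE3 rich_xz]]]]] :=
  fill_edge IHd nEF2 permF2 (sG2 _ _ (sG1 _ _ Gxz))
    (sG2 _ _ (etrans (symG1 _ _) G1nx)) (sG2 _ _ (etrans (symG1 _ _) G1nz)).
have sG3 := adjacency_mono le_n3 sE3.
have {}permF3 : perm_eq (face_keys F3) (sort leq [:: x; y; n] :: (R3 ++ R2 ++ R)).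
  by rewrite catA; apply: perm_front; rewrite -catA.
have [n4 [E4 [F4 [R4 [nEF4 permF4 le_n4 sE4 rich_xy]]]]] :=
  fill_edge IHd nEF3 permF3 (sG3 _ _ (sG2 _ _ (sG1 _ _ Gxy)))
    (sG3 _ _ (sG2 _ _ (etrans (symG1 _ _) G1nx)))
    (sG3 _ _ (sG2 _ _ (etrans (symG1 _ _) G1ny))).
have sG4 := adjacency_mono le_n4 sE4.
exists n4, E4, F4, (R4 ++ R3 ++ R2); split=> //.
- by rewrite -!catA.
- exact: ltnW (leq_trans le_n2 (leq_trans le_n3 le_n4)).
- by move=> u v /sE1/sE2/sE3/sE4.
split=> //; apply: rich_mono sG4 _ => //.
by apply: rich_mono sG3 _.
Qed.

Lemma rich_planar3tree N d :
  exists n E F, planar3tree n E F /\ rich (adjacency n E) N d 0 1.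
Proof.
have [||||n [E [F [R [nEF _ _ _ [rich01 _ _]]]]]] :=
  @fillableP N d _ _ _ 0 1 2 [:: [:: 0; 1; 2]] p3t_base => //.
by exists n, E, F.
Qed.

(** * Realizing states in a layout *)

(** Endpoints of edges stand for the vertices, so the number of vertices does not appear. The strict
    inequalities already make the two edges independent. *)
Definition layout (G : rel nat) (pos : nat -> nat) (c : nat -> nat -> nat) : Prop :=
  [/\ forall u v x y, G u x -> G v y -> pos u = pos v -> u = v,
      forall u v, G u v -> c u v = c v u /\ c u v < 3 &
      forall a b x y, G a b -> G x y ->
        pos a < pos x -> pos x < pos y -> pos y < pos b -> c a b <> c x y].

(** [rho] gives the vertex at each rank. The depth [d] is the number of fans that can still be
    looked at, over any edge of the state. *)
Definition realizes (G : rel nat) N pos c d (s : state) (rho : nat -> nat) : Prop :=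
  (forall r r', r < r' -> r' < s.1 -> pos (rho r) < pos (rho r')) /\
  (forall r, r < s.1 -> exists x, G (rho r) x) /\
  (forall e, e \in s.2 ->
    [/\ e.1.1 < e.1.2, e.1.2 < s.1, rich G N d (rho e.1.1) (rho e.1.2) &
        c (rho e.1.1) (rho e.1.2) = e.2]).

Lemma realizes_nests G N pos c d s rho e f :
  layout G pos c -> realizes G N pos c d s rho -> e \in s.2 -> f \in s.2 ->
  e.2 = f.2 -> ~~ nests e.1 f.1.
Proof.
move=> [_ _ no_nest] [rho_mono [_ s2P]] /s2P[e12 e2s /rich_edge Ge <-].
move=> /s2P[f12 f2s /rich_edge Gf <-] ef.
apply/negP => /orP[] /andP[h1 h2].
  by apply: (no_nest _ _ _ _ Ge Gf _ _ _ ef); apply: rho_mono => //; lia.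
by apply: (no_nest _ _ _ _ Gf Ge _ _ _ (esym ef)); apply: rho_mono => //; lia.
Qed.

(** * Pigeonhole, gaps, and insertion of six vertices into the order *)

Lemma pigeonhole (T : finType) (I : eqType) (f : I -> T) (s : seq I) k :
  k * #|T| < size s -> exists t, k < count (fun i => f i == t) s.
Proof.
move=> ks; apply/existsP; apply: contraLR ks => /existsPn few; rewrite -leqNgt.
have -> : size s = \sum_(t : T) count (fun i => f i == t) s.
  elim: s {few} => [|i s IHs] /=; first by rewrite big1.
  rewrite big_split /= -IHs (bigD1 (f i)) //= eqxx big1 ?add1n // => t.
  by rewrite eq_sym => /negPf->.
rewrite mulnC -sum_nat_const; apply: leq_sum => t _; by rewrite leqNgt.
Qed.

Definition in_gap (pos rho : nat -> nat) (n z y : nat) :=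
  z <= n /\ forall r, r < n -> if r < z then pos (rho r) < pos y else pos y < pos (rho r).

Definition gap_of (pos rho : nat -> nat) (n y : nat) :=
  find (fun r => pos y < pos (rho r)) (iota 0 n).

Lemma gap_ofP pos rho n y :
  (forall r r', r < r' -> r' < n -> pos (rho r) < pos (rho r')) ->
  (forall r, r < n -> pos (rho r) <> pos y) ->
  in_gap pos rho n (gap_of pos rho n y) y.
Proof.
move=> rho_mono yN; rewrite /gap_of; set a := fun r => _; set z := find _ _.
have le_zn : z <= n by rewrite -[X in _ <= X](size_iota 0) find_size.
split=> // r rn; case: ltnP => [rz|zr].
  have := before_find 0 rz; rewrite nth_iota // add0n /a => /negbT.
  by rewrite -leqNgt leq_eqVlt => /predU1P[/(yN _ rn)|].
have za : a z.
  have /(nth_find 0) : has a (iota 0 n) by rewrite has_find size_iota; lia.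
  by rewrite -/z nth_iota //; lia.
case: (ltngtP z r) zr => // [zr|<-] _; last exact: za.
exact: ltn_trans za (rho_mono _ _ zr rn).
Qed.

(** The vertex at each new rank, in five consecutive blocks: old, [y_0] to [y_2], old, [y_3] to
    [y_5], old. It undoes the renumbering by [shift] and [fan_rank]. *)
Definition insertion (z1 z2 : nat) (y rho : nat -> nat) (r : nat) :=
  if r < z1 then rho r else if r < z1 + 3 then y (r - z1) else
  if r < z2 + 3 then rho (r - 3) else if r < z2 + 6 then y (r - z2) else rho (r - 6).

Lemma insertion_fan z1 z2 y rho j :
  z1 <= z2 -> j < 6 -> insertion z1 z2 y rho (fan_rank z1 z2 j) = y j.
Proof.
move=> z12 j6; rewrite /insertion /fan_rank; case: (ltnP j 3) => j3.
  by rewrite ltnNge leq_addr /= ltn_add2l j3 addKn.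
do 3 (rewrite ifF; last by lia).
by rewrite ltn_add2l j6 addKn.
Qed.

Lemma insertion_shift z1 z2 y rho r :
  z1 <= z2 -> insertion z1 z2 y rho (shift z1 z2 r) = rho r.
Proof.
move=> z12; rewrite /insertion /shift; case: (leqP z1 r) => r1; last first.
  by rewrite (leqNgt z2) (leq_trans r1 z12) !addn0 r1.
case: (leqP z2 r) => r2; rewrite !mul1n ?mul0n ?addn0.
  by do 4 (rewrite ifF; last by lia); congr rho; lia.
do 2 (rewrite ifF; last by lia).
by rewrite ifT; [congr rho; lia | lia].
Qed.

Lemma ltn_by_step (f : nat -> nat) n :
  (forall r, r.+1 < n -> f r < f r.+1) -> forall r r', r < r' -> r' < n -> f r < f r'.
Proof.
move=> f_step r r'; elim: r' => // r' IH; rewrite ltnS leq_eqVlt.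
move=> /predU1P[->|rr'] r'n; first exact: f_step.
exact: ltn_trans (IH rr' (ltnW r'n)) (f_step _ r'n).
Qed.

(** It suffices to compare consecutive ranks, inside a block or across a boundary. The vertices
    [y_2] and [y_3] have consecutive ranks only if [z1 = z2]; otherwise old vertices lie between
    them. *)
Lemma insertion_mono pos n rho z1 z2 y :
  (forall r r', r < r' -> r' < n -> pos (rho r) < pos (rho r')) ->
  z1 <= z2 ->
  (forall j, j < 6 -> in_gap pos rho n (if j < 3 then z1 else z2) (y j)) ->
  (forall j, j < 5 -> (j = 2 -> z1 = z2) -> pos (y j) < pos (y j.+1)) ->
  forall r r', r < r' -> r' < n + 6 ->
    pos (insertion z1 z2 y rho r) < pos (insertion z1 z2 y rho r').
Proof.
move=> rho_mono z12 y_gap y_mono.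
apply: (ltn_by_step (f := fun r => pos (insertion z1 z2 y rho r))) => r rn.
have [z2n _] : in_gap pos rho n z2 (y 3) by apply: (y_gap 3).
rewrite /insertion.
have [r1|r1] := ltnP r z1.
  have [r2|r2] := ltnP r.+1 z1; first by apply: rho_mono => //; lia.
  rewrite ifT; last by lia.
  have [_ /(_ r)] := y_gap 0 isT; rewrite /= r1.
  have -> : r.+1 - z1 = 0 by lia.
  by apply; lia.
rewrite [in X in _ < X]ifF; last by lia.
have [r2|r2] := ltnP r (z1 + 3).
  have [r3|r3] := ltnP r.+1 (z1 + 3).
    by rewrite subSn //; apply: y_mono => [|e]; lia.
  have e2 : r - z1 = 2 by lia.
  have [r4|r4] := ltnP r.+1 (z2 + 3).
    rewrite e2; have [_ /(_ (r.+1 - 3))] := y_gap 2 isT.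
    by rewrite /= ifF; [apply; lia | lia].
  rewrite ifT; last by lia.
  have -> : r.+1 - z2 = 3 by lia.
  by rewrite e2; apply: y_mono => [|e]; lia.
rewrite [in X in _ < X]ifF; last by lia.
have [r3|r3] := ltnP r (z2 + 3).
  have [r4|r4] := ltnP r.+1 (z2 + 3).
    by apply: rho_mono; lia.
  rewrite ifT; last by lia.
  have -> : r.+1 - z2 = 3 by lia.
  have [_ /(_ (r - 3))] := y_gap 3 isT.
  by rewrite /= ifT; [apply; lia | lia].
rewrite [in X in _ < X]ifF; last by lia.
have [r4|r4] := ltnP r (z2 + 6).
  have [r5|r5] := ltnP r.+1 (z2 + 6).
    by rewrite subSn; [apply: y_mono => [|e]; lia | lia].
  have -> : r - z2 = 5 by lia.
  have [_ /(_ (r.+1 - 6))] := y_gap 5 isT.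
  by rewrite /= ifF; [apply; lia | lia].
rewrite [in X in _ < X]ifF; last by lia.
by apply: rho_mono; lia.
Qed.

Lemma shift_lt z1 z2 a b : (shift z1 z2 a < shift z1 z2 b) = (a < b).
Proof. rewrite /shift; lia. Qed.

Lemma shift_bound z1 z2 a n : a < n -> shift z1 z2 a < n + 6.
Proof. rewrite /shift; lia. Qed.

Lemma shift_lt_fan z1 z2 a j : z1 <= z2 -> j < 6 ->
  (shift z1 z2 a < fan_rank z1 z2 j) = (a < if j < 3 then z1 else z2).
Proof. rewrite /shift /fan_rank; case: (ltnP j 3); lia. Qed.

Lemma fan_lt_shift z1 z2 a j : z1 <= z2 -> j < 6 ->
  (fan_rank z1 z2 j < shift z1 z2 a) = ((if j < 3 then z1 else z2) <= a).
Proof. rewrite /shift /fan_rank; case: (ltnP j 3); lia. Qed.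

Lemma fan_rank_lt z1 z2 i j : z1 <= z2 -> i < j -> fan_rank z1 z2 i < fan_rank z1 z2 j.
Proof. rewrite /fan_rank; case: (ltnP i 3); case: (ltnP j 3); lia. Qed.

Lemma fan_rank_bound z1 z2 n j : z1 <= z2 <= n -> j < 6 -> fan_rank z1 z2 j < n + 6.
Proof. rewrite /fan_rank; case: (ltnP j 3); lia. Qed.

Lemma fan_pairsP b i : i \in fan_pairs b -> [/\ i.1 < i.2, i.2 < 6 & ~~ b -> i.1 < 3 <= i.2].
Proof. by case: b; rewrite !inE => /or3P[] /eqP->. Qed.

Lemma fan_pairs_cover b j : j < 6 -> exists2 i, i \in fan_pairs b & j = i.1 \/ j = i.2.
Proof.
case: b; case: j => [|[|[|[|[|[|j]]]]]] // _;
  solve [by exists (0, 1); [|left] | by exists (0, 1); [|right]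
        |by exists (2, 3); [|left] | by exists (2, 3); [|right]
        |by exists (4, 5); [|left] | by exists (4, 5); [|right]
        |by exists (0, 3); [|left] | by exists (0, 3); [|right]
        |by exists (1, 4); [|left] | by exists (1, 4); [|right]
        |by exists (2, 5); [|left] | by exists (2, 5); [|right]].
Qed.

Lemma rich_pred G N d u v : rich G N d.+1 u v -> rich G N d u v.
Proof.
elim: d u v => [|d IHd] u v [Guv [x [x_mono x_rich]]] //=.
split=> //; exists x; split=> // i /x_rich[? ? ?].
by split; apply: IHd.
Qed.

Definition fan_groups u v z1 z2 b (c c' : nat * nat) k :=
  (rungs z1 z2 b, k) :: spokes u v z1 z2 b c c'.

Lemma expandE s u v z1 z2 b c c' k :
  expand s u v z1 z2 b c c' k =
  (s.1 + 6, flatten (map paint (fan_groups u v z1 z2 b c c' k)) ++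
            [seq (shift z1 z2 e.1.1, shift z1 z2 e.1.2, e.2) | e <- s.2]).
Proof. by []. Qed.

Lemma realizes_expand G N pos c d s rho u v z1 z2 b cc cc' k y :
  symmetric G -> layout G pos c -> realizes G N pos c d s rho ->
  u < s.1 -> v < s.1 -> z1 <= z2 ->
  (forall j, j < 6 -> in_gap pos rho s.1 (if j < 3 then z1 else z2) (y j)) ->
  (forall j, j < 5 -> (j = 2 -> z1 = z2) -> pos (y j) < pos (y j.+1)) ->
  (forall i, i \in fan_pairs b ->
    [/\ rich G N d (rho u) (y i.1), rich G N d (rho v) (y i.1), rich G N d (rho u) (y i.2),
        rich G N d (rho v) (y i.2) & rich G N d (y i.1) (y i.2)]) ->
  (forall i, i \in fan_pairs b ->
    [/\ c (rho u) (y i.1) = cc.1, c (rho v) (y i.1) = cc.2, c (rho u) (y i.2) = cc'.1,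
        c (rho v) (y i.2) = cc'.2 & c (y i.1) (y i.2) = k]) ->
  realizes G N pos c d (expand s u v z1 z2 b cc cc' k) (insertion z1 z2 y rho).
Proof.
move=> symG [_ c_sym _] [rho_mono [rhoG sP]] us vs z12 y_gap y_mono y_rich y_col.
have z2s : z2 <= s.1 by case: (y_gap 3 isT).
split; first exact: insertion_mono.
have yG j : j < 6 -> exists x, G (y j) x.
  case/(fan_pairs_cover b) => i ib [] ->; have [_ _ _ _ /rich_edge Gy] := y_rich i ib.
    by exists (y i.2).
  by exists (y i.1); rewrite symG.
split.
  move=> r rs; rewrite /insertion; rewrite /= in rs.
  have [?|?] := ltnP r z1; first by apply: rhoG; lia.
  have [?|?] := ltnP r (z1 + 3); first by apply: yG; lia.
  have [?|?] := ltnP r (z2 + 3); first by apply: rhoG; lia.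
  by have [?|?] := ltnP r (z2 + 6); [apply: yG; lia | apply: rhoG; lia].
set rho' := insertion z1 z2 y rho.
pose good e := [/\ e.1.1 < e.1.2, e.1.2 < s.1 + 6, rich G N d (rho' e.1.1) (rho' e.1.2) &
                   c (rho' e.1.1) (rho' e.1.2) = e.2].
(* Depending on the gap, the edge starts at the old or at the new vertex; the symmetry of [G] and of
   [c] handles the second case. *)
have chord_good w j k' : w < s.1 -> j < 6 -> rich G N d (rho w) (y j) -> c (rho w) (y j) = k' ->
    good (chord (shift z1 z2 w) (fan_rank z1 z2 j), k').
  move=> ws j6 wj_rich wj_col.
  have sw := shift_bound z1 z2 ws.
  have fj : fan_rank z1 z2 j < s.1 + 6 by apply: fan_rank_bound; rewrite ?z12.
  have lt := shift_lt_fan w z12 j6; have gt := fan_lt_shift w z12 j6.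
  have rhoS : rho' (shift z1 z2 w) = rho w by apply: insertion_shift.
  have rhoF : rho' (fan_rank z1 z2 j) = y j by apply: insertion_fan.
  rewrite /good /chord; have [wj|jw] := ltnP (shift z1 z2 w); rewrite /= rhoS rhoF.
    by split.
  split=> //; first by rewrite gt leqNgt -lt -leqNgt.
    exact: rich_sym.
  by rewrite -wj_col; case: (c_sym _ _ (rich_edge wj_rich)).
move=> e; rewrite expandE mem_cat => /orP[|/mapP[e0 /sP[e12 es e_rich e_col] ->]]; last first.
  rewrite /= /rho' !insertion_shift //; split=> //; first by rewrite shift_lt.
  exact: shift_bound.
move=> /flatten_mapP[g gP /mapP[f fg ->]]; rewrite -/(good _).
move: gP fg; rewrite !inE => /predU1P[->|].
  move=> /mapP[i ib ->]; have [i12 i6 _] := fan_pairsP ib.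
  have [_ _ _ _ r5] := y_rich i ib; have [_ _ _ _ c5] := y_col i ib.
  have i16 := ltn_trans i12 i6.
  rewrite /good /= /rho' !insertion_fan //.
  split=> //; first exact: fan_rank_lt.
  by apply: fan_rank_bound; rewrite ?z12.
by move=> /or4P[] /eqP-> /mapP[i ib ->]; have [i12 i6 _] := fan_pairsP ib;
  have [? ? ? ? ?] := y_rich i ib; have [? ? ? ? ?] := y_col i ib;
  apply: chord_good => //; apply: ltn_trans i6.
Qed.

(** * Completeness of the list of responses *)

Lemma pairwise_in (T : eqType) (r : rel T) s : {in s &, forall x y, r x y} -> pairwise r s.
Proof.
elim: s => //= x s IHs rs; apply/andP; split.
  by apply/allP => y ys; apply: rs; rewrite inE ?eqxx ?ys ?orbT.
by apply: IHs => y z ys zs; apply: rs; rewrite inE ?ys ?zs orbT.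
Qed.

(** Comparing [2z] with [2r + 1] tells whether gap [z] is before or after rank [r], which is how an
    inserted vertex compares with the old one. So the prefilter on the old state detects nestings of
    the expanded state. *)
Lemma nests_spoke z1 z2 u a b j : z1 <= z2 -> j < 6 ->
  nests (chord u.*2.+1 (if j < 3 then z1 else z2).*2) (a.*2.+1, b.*2.+1) ->
  nests (chord (shift z1 z2 u) (fan_rank z1 z2 j)) (shift z1 z2 a, shift z1 z2 b).
Proof.
move=> z12 j6.
set z := (if j < 3 then z1 else z2).
rewrite /nests /chord shift_lt_fan // -/z.
have -> : (u.*2.+1 < z.*2) = (u < z) by lia.
by case: (ltnP u z) => uz; rewrite /= !shift_lt ?shift_lt_fan ?fan_lt_shift // -/z; lia.
Qed.

Lemma nests_rung z1 z2 a b i j : z1 <= z2 -> i < 6 -> j < 6 ->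
  nests ((if i < 3 then z1 else z2).*2, (if j < 3 then z1 else z2).*2) (a.*2.+1, b.*2.+1) ->
  nests (fan_rank z1 z2 i, fan_rank z1 z2 j) (shift z1 z2 a, shift z1 z2 b).
Proof.
move=> z12 i6 j6; rewrite /nests /= !fan_lt_shift // !shift_lt_fan //; lia.
Qed.

(** Every test in [responses] that could discard the expansion would exhibit two nested edges of one
    colour in it. *)
Lemma expand_responses s u v z1 z2 b c c' k :
  let s' := expand s u v z1 z2 b c c' k in
  {in s'.2 &, forall e f, e.2 = f.2 -> ~~ nests e.1 f.1} ->
  u < v -> z1 <= z2 <= s.1 -> (b -> z1 = z2) ->
  [/\ c.1 < 3, c.2 < 3, c'.1 < 3, c'.2 < 3 & k < 3] ->
  s' \in responses s u v.
Proof.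
move=> s' no_nest uv /andP[z12 z2s] bz [c1 c2 c1' c2' k3].
set gs := fan_groups u v z1 z2 b c c' k.
have groupP g e : g \in gs -> e \in g.1 -> (e, g.2) \in s'.2.
  move=> gP eg; rewrite /s' expandE mem_cat; apply/orP; left.
  by apply/flatten_mapP; exists g => //; apply: map_f.
have compat : {in gs &, forall g h, compatible g h}.
  move=> g h gP hP; apply/implyP => /eqP gh.
  apply/hasPn => e eg; apply/hasPn => f fh.
  exact: (no_nest (e, g.2) (f, h.2)) (groupP _ _ gP eg) (groupP _ _ hP fh) gh.
have oldP e : e \in s.2 -> (shift z1 z2 e.1.1, shift z1 z2 e.1.2, e.2) \in s'.2.
  by move=> es; rewrite /s' expandE mem_cat (map_f (fun e => (_, _, e.2))) ?orbT.
have up i : i \in fan_pairs b -> (chord (shift z1 z2 u) (fan_rank z1 z2 i.1), c.1) \in s'.2.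
  move=> ib; pose f (i : nat * nat) := chord (shift z1 z2 u) (fan_rank z1 z2 i.1).
  apply: (groupP (map f (fan_pairs b), c.1)); rewrite ?inE ?eqxx ?orbT //.
  exact: (map_f f).
have vp i : i \in fan_pairs b -> (chord (shift z1 z2 v) (fan_rank z1 z2 i.1), c.2) \in s'.2.
  move=> ib; pose f (i : nat * nat) := chord (shift z1 z2 v) (fan_rank z1 z2 i.1).
  apply: (groupP (map f (fan_pairs b), c.2)); rewrite ?inE ?eqxx ?orbT //.
  exact: (map_f f).
have uq i : i \in fan_pairs b -> (chord (shift z1 z2 u) (fan_rank z1 z2 i.2), c'.1) \in s'.2.
  move=> ib; pose f (i : nat * nat) := chord (shift z1 z2 u) (fan_rank z1 z2 i.2).
  apply: (groupP (map f (fan_pairs b), c'.1)); rewrite ?inE ?eqxx ?orbT //.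
  exact: (map_f f).
have vq i : i \in fan_pairs b -> (chord (shift z1 z2 v) (fan_rank z1 z2 i.2), c'.2) \in s'.2.
  move=> ib; pose f (i : nat * nat) := chord (shift z1 z2 v) (fan_rank z1 z2 i.2).
  apply: (groupP (map f (fan_pairs b), c'.2)); rewrite ?inE ?eqxx ?orbT //.
  exact: (map_f f).
have freeP e k' : k' < 3 ->
    (forall f, f \in s.2 -> nests e (f.1.1.*2.+1, f.1.2.*2.+1) ->
       exists2 e', (e', k') \in s'.2 & nests e' (shift z1 z2 f.1.1, shift z1 z2 f.1.2)) ->
    k' \in free [seq (e.1.1.*2.+1, e.1.2.*2.+1, e.2) | e <- s.2] e.
  move=> k3' eP; rewrite mem_filter mem_iota add0n leq0n k3' /= andbT.
  apply/hasPn => _ /mapP[f fs ->]; apply/negP => /andP[/eqP fk /= /(eP _ fs)[e' es']].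
  exact/negP/(no_nest (e', k') _ es' (oldP _ fs)).
have gapP (cc : nat * nat) z j0 j1 : cc.1 < 3 -> cc.2 < 3 -> j0 < j1 -> j1 < 6 ->
    (if j0 < 3 then z1 else z2) = z -> (if j1 < 3 then z1 else z2) = z ->
    (chord (shift z1 z2 u) (fan_rank z1 z2 j0), cc.1) \in s'.2 ->
    (chord (shift z1 z2 v) (fan_rank z1 z2 j0), cc.2) \in s'.2 ->
    (chord (shift z1 z2 u) (fan_rank z1 z2 j1), cc.1) \in s'.2 ->
    (chord (shift z1 z2 v) (fan_rank z1 z2 j1), cc.2) \in s'.2 ->
    cc \in gap_colours [seq (e.1.1.*2.+1, e.1.2.*2.+1, e.2) | e <- s.2] u v z.
  move=> cc1 cc2 j01 j16 j0z j1z u0 v0 u1 v1.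
  have j06 := ltn_trans j01 j16.
  rewrite mem_filter; apply/andP; split; last first.
    case: cc cc1 cc2 u0 v0 {u1 v1} => cc1 cc2 /= cc13 cc23 u0 v0.
    apply: allpairs_f; apply: freeP => // f _; rewrite -j0z.
      by move=> /(nests_spoke z12 j06); exists (chord (shift z1 z2 u) (fan_rank z1 z2 j0)).
    by move=> /(nests_spoke z12 j06); exists (chord (shift z1 z2 v) (fan_rank z1 z2 j0)).
  (* Let [y0] precede [y1] in a gap outside the interval from [u] to [v]. Before [u], the edge
     [y0 v] encloses [y1 u]; after [v], the edge [u y1] encloses [v y0]. Either way equal colours
     are impossible. *)
  apply: contraT; rewrite negb_or negbK => /andP[uzv /eqP cc12].
  have := no_nest _ _ v0 u1 (esym cc12); have := no_nest _ _ u1 v0 cc12.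
  rewrite /nests /chord !shift_lt_fan // j0z j1z.
  have y01 := fan_rank_lt z12 j01.
  have [zu|uz] := leqP z u.
    have -> : (v < z) = false by lia.
    by rewrite /= y01 !shift_lt uv orbT.
  have -> : v < z by lia.
  by rewrite /= y01 !shift_lt uv.
(* The first two pairs of the pattern provide two p-vertices in gap [z1] and two q-vertices in gap
   [z2], as [gapP] requires. *)
pose i0 := (0, if b then 1 else 3); pose i1 := (if b then 2 else 1, if b then 3 else 4).
have i0b : i0 \in fan_pairs b by rewrite /i0; case: (b).
have i1b : i1 \in fan_pairs b by rewrite /i1; case: (b).
have gap1 : c \in gap_colours [seq (e.1.1.*2.+1, e.1.2.*2.+1, e.2) | e <- s.2] u v z1.
  apply: (gapP _ _ _ _ _ _ _ _ _ _ (up _ i0b) (vp _ i0b) (up _ i1b) (vp _ i1b)) => //;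
  by rewrite /i1 /=; case: (b).
have gap2 : c' \in gap_colours [seq (e.1.1.*2.+1, e.1.2.*2.+1, e.2) | e <- s.2] u v z2.
  apply: (gapP _ _ _ _ _ _ _ _ _ _ (uq _ i0b) (vq _ i0b) (uq _ i1b) (vq _ i1b)) => //;
  by rewrite /i0 /i1 /=; case: (b) bz => // ->.
have kP : k \in free [seq (e.1.1.*2.+1, e.1.2.*2.+1, e.2) | e <- s.2] (z1.*2, z2.*2).
  apply: freeP => // f _ fk; exists (fan_rank z1 z2 i0.1, fan_rank z1 z2 i0.2).
    exact: (groupP (_, _)) (mem_head _ _)
      (map_f (fun i => (fan_rank z1 z2 i.1, fan_rank z1 z2 i.2)) i0b).
  apply: nests_rung; rewrite /i0 //=; first by case: (b).
  by case: (b) bz fk => // /(_ isT) ->.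
move: gap1 gap2 kP; rewrite /responses; set es := [seq _ | e <- s.2] => gap1 gap2 kP.
set gaps := [seq g <- _ | _].
have gapsP z (cc : nat * nat) : z <= s.1 -> cc \in gap_colours es u v z ->
    (z, gap_colours es u v z) \in gaps.
  move=> zs ccP; rewrite mem_filter; apply/andP; split.
    by apply/negP => /nilP /= gap0; rewrite gap0 in ccP.
  by apply: (map_f (fun z => (z, gap_colours es u v z))); rewrite mem_iota.
have g1 := gapsP _ _ (leq_trans z12 z2s) gap1; have g2 := gapsP _ _ z2s gap2.
apply/flattenP; eexists; first exact: allpairs_f g1 g2.
rewrite ifF; last by rewrite /= ltnNge z12.
apply/flatten_mapP; exists b.
  by case: (b) bz => [->|_] //=; [rewrite eqxx | case: eqP].
apply/flatten_mapP; exists c => //; apply/flatten_mapP; exists c' => //.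
have sub_gs : {subset spokes u v z1 z2 b c c' <= gs} by move=> g gP; rewrite inE gP orbT.
rewrite ifT; last first.
  apply/andP; split; last by apply/allP => g /sub_gs gP; apply: compat.
  by apply: pairwise_in => g h /sub_gs gP /sub_gs hP; apply: compat.
apply: (map_f (expand s u v z1 z2 b c c')); rewrite mem_filter kP andbT.
by apply/allP => g gP; apply: compat => //; apply: mem_head.
Qed.

(** * Uniform pairs in a long fan: two gaps and five colours per pair *)

Definition fan_type n :=
  ('I_n.+1 * 'I_n.+1 * ('I_3 * 'I_3 * 'I_3 * 'I_3 * 'I_3))%type.

Lemma in_gap_le pos rho n z1 z2 y1 y2 :
  in_gap pos rho n z1 y1 -> in_gap pos rho n z2 y2 -> pos y1 < pos y2 -> z1 <= z2.
Proof.
move=> [z1n gap1] [z2n gap2] y12; rewrite leqNgt; apply/negP => z21.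
have := gap1 z2 (leq_trans z21 z1n); have := gap2 z2 (leq_trans z21 z1n).
by rewrite z21 ltnn; lia.
Qed.

(** If [p_2] precedes [q_0] or [p_4] precedes [q_2], then three consecutive pairs cross. Otherwise
    [q_0] precedes [p_2] and [q_2] precedes [p_4], so the pairs 0, 2, 4 follow one another. This is
    why five pairs are taken. *)
Lemma arrange_pairs pos rho n z1 z2 p q :
  z1 <= z2 ->
  (forall j, j < 5 -> in_gap pos rho n z1 (p j)) ->
  (forall j, j < 5 -> in_gap pos rho n z2 (q j)) ->
  (forall j, j < 5 -> pos (p j) < pos (q j)) ->
  (forall i j, i < j -> j < 5 -> pos (p i) < pos (p j)) ->
  (forall i j, i < j -> j < 5 -> pos (q i) < pos (q j)) ->
  (forall i j, i < 5 -> j < 5 -> pos (p i) <> pos (q j)) ->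
  exists (b : bool) y, [/\ b -> z1 = z2,
    forall j, j < 6 -> in_gap pos rho n (if j < 3 then z1 else z2) (y j),
    forall j, j < 5 -> (j = 2 -> z1 = z2) -> pos (y j) < pos (y j.+1) &
    forall i, i \in fan_pairs b -> exists j, [/\ j < 5, y i.1 = p j & y i.2 = q j]].
Proof.
move=> z12 p_gap q_gap pq p_mono q_mono pNq.
have crossing a : a < 3 -> (z1 = z2 -> pos (p a.+2) < pos (q a)) ->
    exists (b : bool) y, [/\ b -> z1 = z2,
      forall j, j < 6 -> in_gap pos rho n (if j < 3 then z1 else z2) (y j),
      forall j, j < 5 -> (j = 2 -> z1 = z2) -> pos (y j) < pos (y j.+1) &
      forall i, i \in fan_pairs b -> exists j, [/\ j < 5, y i.1 = p j & y i.2 = q j]].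
  move=> a3 pqa.
  exists false, (nth 0 [:: p a; p a.+1; p a.+2; q a; q a.+1; q a.+2]); split=> //.
  - by do 6 (case=> [_|]; first by [apply: p_gap; lia | apply: q_gap; lia]).
  - do 2 (case=> [_ _|]; first by apply: p_mono; lia).
    case=> [_ /(_ erefl)/pqa //|].
    by do 2 (case=> [_ _|]; first by apply: q_mono; lia).
  move=> i; rewrite !inE => /or3P[] /eqP->.
  - by exists a; split=> //; lia.
  - by exists a.+1; split=> //; lia.
  by exists a.+2; split=> //; lia.
(* In different gaps any three pairs cross, since old vertices separate the p-vertices from the
   q-vertices. *)
have [z_lt|z_ge] := ltnP z1 z2; first by apply: (crossing 0) => // ez; lia.
have ez : z1 = z2 by lia.
have [lt0|ge0] := ltnP (pos (p 2)) (pos (q 0)); first exact: (crossing 0).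
have [lt2|ge2] := ltnP (pos (p 4)) (pos (q 2)); first exact: (crossing 2).
have {}ge0 : pos (q 0) < pos (p 2).
  by rewrite ltn_neqAle ge0 andbT; apply/eqP => /esym; apply: pNq.
have {}ge2 : pos (q 2) < pos (p 4).
  by rewrite ltn_neqAle ge2 andbT; apply/eqP => /esym; apply: pNq.
exists true, (nth 0 [:: p 0; q 0; p 2; q 2; p 4; q 4]); split=> //.
- move=> j; rewrite -ez if_same.
  move: j; do 6 (case=> [_|]; first by [apply: p_gap | rewrite ez; apply: q_gap]); by [].
- by do 5 (case=> [_ _|]; first by [apply: pq | ]); by [].
move=> i; rewrite !inE => /or3P[] /eqP->.
- by exists 0.
- by exists 2.
by exists 4.
Qed.

Lemma uniform_pairs G N pos c d n rho U V x :
  symmetric G -> layout G pos c ->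
  (forall r r', r < r' -> r' < n -> pos (rho r) < pos (rho r')) ->
  (forall i, i < N.*2 -> x i < x i.+1) ->
  (forall i, i < N.*2 ->
    [/\ rich G N d U (x i), rich G N d V (x i) & rich G N d (x i) (x i.+1)]) ->
  n + 4 * #|{: fan_type n}| < N ->
  exists z1 z2 p q cc cc' k,
    [/\ z1 <= z2,
     forall j, j < 5 -> [/\ in_gap pos rho n z1 (p j), in_gap pos rho n z2 (q j) &
                            pos (p j) < pos (q j)],
     forall i j, i < j -> j < 5 -> pos (p i) < pos (p j) /\ pos (q i) < pos (q j),
     forall i j, i < 5 -> j < 5 -> pos (p i) <> pos (q j) &
     forall j, j < 5 ->
       [/\ rich G N d U (p j), rich G N d V (p j), rich G N d U (q j),
           rich G N d V (q j) & rich G N d (p j) (q j)] /\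
       [/\ c U (p j) = cc.1, c V (p j) = cc.2, c U (q j) = cc'.1,
           c V (q j) = cc'.2 & c (p j) (q j) = k]].
Proof.
move=> symG [pos_inj c_sym no_nest] rho_mono x_mono x_rich N_big.
have x_lt i j : i < j -> j < N.*2.+1 -> x i < x j by apply: ltn_by_step => r; apply: x_mono.
have xG i : i < N.*2 -> G (x i) (x i.+1) by move=> /x_rich[_ _ /rich_edge].
have pos_x i j : i < N.*2 -> j < N.*2 -> pos (x i) = pos (x j) -> i = j.
  move=> iN jN /(pos_inj _ _ _ _ (xG i iN) (xG j jN)) xij.
  case: (ltngtP i j) => // ij.
    by have := x_lt _ _ ij (leqW jN); rewrite xij ltnn.
  by have := x_lt _ _ ij (leqW iN); rewrite xij ltnn.
(* Each pair is oriented along the layout, so that [p i] comes first; the roles of the two fan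
   vertices are symmetric. *)
pose sw i := pos (x i.*2) < pos (x i.*2.+1).
pose p i := if sw i then x i.*2 else x i.*2.+1.
pose q i := if sw i then x i.*2.+1 else x i.*2.
have pq i : i < N -> pos (p i) < pos (q i).
  move=> iN; rewrite /p /q; case: ifP => // /negbT; rewrite -leqNgt leq_eqVlt.
  by case/predU1P => // /pos_x; lia.
have pq_rich i : i < N -> [/\ rich G N d U (p i), rich G N d V (p i), rich G N d U (q i),
           rich G N d V (q i) & rich G N d (p i) (q i)].
  move=> iN.
  have [|u0 v0 x01] := x_rich i.*2; first lia.
  have [|u1 v1 _] := x_rich i.*2.+1; first lia.
  by rewrite /p /q; case: ifP => _; split=> //; apply: rich_sym.
have p_inj i j : i < N -> j < N -> pos (p i) = pos (p j) -> i = j.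
  move=> iN jN; rewrite /p; do 2 case: ifP => _; move/pos_x; lia.
have q_inj i j : i < N -> j < N -> pos (q i) = pos (q j) -> i = j.
  move=> iN jN; rewrite /q; do 2 case: ifP => _; move/pos_x; lia.
have pNq i j : i < N -> j < N -> pos (p i) <> pos (q j).
  move=> iN jN e; have ij : i = j.
    by move: e; rewrite /p /q; do 2 case: ifP => _; move/pos_x; lia.
  by have := pq i iN; rewrite e ij ltnn.
pose used := [seq pos (rho r) | r <- iota 0 n].
pose hit i := (pos (p i) \in used) || (pos (q i) \in used).
(* Sending each spoiled pair to an old position it occupies is injective, because the pairs are
   disjoint; so at most [n] pairs are lost. *)
have hits : count hit (iota 0 N) <= n.
  pose h i := if pos (p i) \in used then pos (p i) else pos (q i).
  rewrite -size_filter -(size_map h) -[leqRHS](size_iota 0).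
  rewrite -[leqRHS](size_map (fun r => pos (rho r))).
  apply: uniq_leq_size.
    rewrite map_inj_in_uniq; first by rewrite filter_uniq ?iota_uniq.
    move=> i j.
    rewrite !mem_filter !mem_iota !add0n => /andP[_ iN] /andP[_ jN].
    rewrite /h; do 2 case: ifP => _.
    - exact: p_inj.
    - by move/(pNq _ _ iN jN).
    - by move/esym/(pNq _ _ jN iN).
    exact: q_inj.
  move=> _ /mapP[i + ->]; rewrite mem_filter /hit /h => /andP[+ _].
  by case: ifP.
pose fresh := [seq i <- iota 0 N | ~~ hit i].
have freshP i : i \in fresh ->
    [/\ i < N, in_gap pos rho n (gap_of pos rho n (p i)) (p i) &
        in_gap pos rho n (gap_of pos rho n (q i)) (q i)].
  rewrite mem_filter mem_iota add0n negb_or => /andP[/andP[pu qu] iN].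
  split=> //; apply: gap_ofP => // r rn e; [move: pu | move: qu]; rewrite -e;
    by rewrite (map_f (fun r => pos (rho r))) // mem_iota.
have size_fresh : 4 * #|{: fan_type n}| < size fresh.
  rewrite size_filter; have := count_predC hit (iota 0 N); rewrite size_iota.
  have -> : count (predC hit) (iota 0 N) = count (fun i => ~~ hit i) (iota 0 N) by [].
  lia.
pose f i : fan_type n :=
  (inord (gap_of pos rho n (p i)), inord (gap_of pos rho n (q i)),
   (inord (c U (p i)), inord (c V (p i)), inord (c U (q i)), inord (c V (q i)),
    inord (c (p i) (q i)))).
have [t] := pigeonhole f size_fresh.
rewrite -size_filter; set l := filter _ _ => size_l.
(* More than four fresh pairs have the type [t]. They are sorted by the position of their first
   vertex, and the first five are used. *)
pose le i j := pos (p i) <= pos (p j).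
pose w := nth 0 (sort le l).
have wl j : j < 5 -> w j \in l.
  by move=> j5; rewrite -(mem_sort le) mem_nth // size_sort (leq_trans j5).
have w_fresh j : j < 5 -> w j \in fresh by move=> /wl; rewrite mem_filter => /andP[].
have wN j : j < 5 -> w j < N by move=> /w_fresh/freshP[].
have wf j : j < 5 -> f (w j) = f (w 0).
  have ft i : i < 5 -> f (w i) = t by move=> /wl; rewrite mem_filter => /andP[/eqP].
  by move=> j5; rewrite !ft.
have w_inj i j : i < 5 -> j < 5 -> w i = w j -> i = j.
  move=> i5 j5 /eqP; rewrite nth_uniq ?size_sort ?(leq_trans i5) ?(leq_trans j5) //.
    by move/eqP.
  by rewrite sort_uniq !filter_uniq // iota_uniq.
have p_mono i j : i < j -> j < 5 -> pos (p (w i)) < pos (p (w j)).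
  move=> ij j5; have i5 := ltn_trans ij j5.
  have : le (w i) (w j).
    apply: (sorted_ltn_nth (leT := le)) => //.
    - by move=> ? ? ?; apply: leq_trans.
    - by apply: sort_sorted => ? ?; apply: leq_total.
    - by rewrite inE size_sort (leq_trans i5).
    - by rewrite inE size_sort (leq_trans j5).
  rewrite /le leq_eqVlt => /predU1P[/p_inj e|//].
  by have := w_inj _ _ i5 j5 (e (wN _ i5) (wN _ j5)); lia.
have w_col j : j < 5 ->
    [/\ c U (p (w j)) = c U (p (w 0)), c V (p (w j)) = c V (p (w 0)),
        c U (q (w j)) = c U (q (w 0)), c V (q (w j)) = c V (q (w 0)) &
        c (p (w j)) (q (w j)) = c (p (w 0)) (q (w 0))].
  have inord3 a b a' b' : rich G N d a b -> rich G N d a' b' ->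
      inord (c a b) = inord (c a' b') :> 'I_3 -> c a b = c a' b'.
    move=> /rich_edge/c_sym[_ cab] /rich_edge/c_sym[_ cab'] /(congr1 val).
    by rewrite /= !inordK.
  move=> j5; have [r1 r2 r3 r4 r5] := pq_rich _ (wN j j5).
  have [s1 s2 s3 s4 s5] := pq_rich _ (wN 0 isT).
  by case: (wf _ j5) => _ _ e1 e2 e3 e4 e5; split; apply: inord3.
have w_gap j : j < 5 -> gap_of pos rho n (p (w j)) = gap_of pos rho n (p (w 0)) /\
                        gap_of pos rho n (q (w j)) = gap_of pos rho n (q (w 0)).
  move=> j5; have [_ [gp _] [gq _]] := freshP _ (w_fresh _ j5).
  have [_ [gp0 _] [gq0 _]] := freshP _ (w_fresh 0 isT).
  by case: (wf _ j5) => /(congr1 val) + /(congr1 val) + _ _ _ _ _; rewrite /= !inordK.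
exists (gap_of pos rho n (p (w 0))), (gap_of pos rho n (q (w 0))), (p \o w), (q \o w).
exists (c U (p (w 0)), c V (p (w 0))), (c U (q (w 0)), c V (q (w 0))), (c (p (w 0)) (q (w 0))).
split=> /=.
- have [N0 gp gq] := freshP _ (w_fresh 0 isT).
  exact: in_gap_le gp gq (pq _ N0).
- move=> j j5; have [jN gp gq] := freshP _ (w_fresh _ j5).
  by have [<- <-] := w_gap _ j5; split=> //; apply: pq.
- move=> i j ij j5; have i5 := ltn_trans ij j5.
  have lt_p := p_mono _ _ ij j5; split=> //.
  (* If the q-vertices came in the opposite order, the edges [p_i q_i] and [p_j q_j] would be nested
     and of the same colour. *)
  case: ltngtP => // [lt_q|/q_inj e]; last first.
    by have := w_inj _ _ i5 j5 (e (wN _ i5) (wN _ j5)); lia.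
  have [_ _ _ _ /rich_edge Gi] := pq_rich _ (wN _ i5).
  have [_ _ _ _ /rich_edge Gj] := pq_rich _ (wN _ j5).
  case: (no_nest _ _ _ _ Gi Gj lt_p (pq _ (wN _ j5)) lt_q).
  by have [_ _ _ _ ->] := w_col _ i5; have [_ _ _ _ ->] := w_col _ j5.
- by move=> i j i5 j5; apply: pNq; apply: wN.
by move=> j j5; split; [apply: pq_rich; apply: wN | apply: w_col].
Qed.

(** * Playing the game against a layout *)

Lemma fan_step G N pos c d s rho u v :
  symmetric G -> layout G pos c -> realizes G N pos c d.+1 s rho ->
  s.1 + 4 * #|{: fan_type s.1}| < N -> has (fun e => e.1 == (u, v)) s.2 ->
  exists2 s', s' \in responses s u v & exists rho', realizes G N pos c d s' rho'.
Proof.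
move=> symG L [rho_mono [rhoG sP]] N_big /hasP[[e k0] es /= /eqP e_uv].
have := sP _ es; rewrite /= e_uv /= => -[uv vs [_ [x [x_mono x_rich]]] _].
have us := ltn_trans uv vs.
have [z1 [z2 [p [q [cc [cc' [k [z12 pq_gap pq_mono pNq pq_rich]]]]]]]] :=
  uniform_pairs symG L rho_mono x_mono x_rich N_big.
have [|||||b [y [bz y_gap y_mono yP]]] :=
  @arrange_pairs pos rho s.1 z1 z2 p q z12 _ _ _ _ _ pNq.
- by move=> j /pq_gap[].
- by move=> j /pq_gap[].
- by move=> j /pq_gap[].
- by move=> i j ij /(pq_mono _ _ ij)[].
- by move=> i j ij /(pq_mono _ _ ij)[].
(* The old edges give up one level of richness, to agree with the new edges, which have depth [d]
   only. *)
have R : realizes G N pos c d s rho.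
  split=> //; split=> // f /sP[? ? /rich_pred ? ?]; by split.
have R' : realizes G N pos c d (expand s u v z1 z2 b cc cc' k) (insertion z1 z2 y rho).
  by apply: realizes_expand => // i /yP[j [j5 -> ->]]; have [] := pq_rich j j5.
exists (expand s u v z1 z2 b cc cc' k); last by eexists; exact: R'.
apply: expand_responses => //.
- move=> e1 e2 e1s e2s e12; exact: realizes_nests L R' e1s e2s e12.
- by rewrite z12; case: (y_gap 3 isT).
have [[r1 r2 r3 r4 r5] [<- <- <- <- <-]] := pq_rich 0 isT.
have [_ c_sym _] := L.
by move: r1 r2 r3 r4 r5; do 5 move=> /rich_edge/c_sym[_ ?].
Qed.

Lemma responses_size s u v s' : s' \in responses s u v -> s'.1 = s.1 + 6.
Proof.
move=> /flattenP[_ /allpairsP[[g h] [_ _ ->]]].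
case: (h.1 < g.1) => // /flatten_mapP[b _ /flatten_mapP[cc _ /flatten_mapP[cc' _]]].
by move=> /=; case: (_ && _) => // /mapP[k _ ->].
Qed.

(** The quantity [s.1 + 6 * d] is constant during the play, so one bound on [N] serves all its
    fans. *)
Lemma wins_sound G N pos c d t s rho :
  symmetric G -> layout G pos c -> (forall n, n <= s.1 + 6 * d -> n + 4 * #|{: fan_type n}| < N) ->
  wins d t s -> realizes G N pos c d s rho -> False.
Proof.
move=> symG L; elim: d t s rho => [//|d IHd] [u v ts] s rho N_big /= /andP[uv ts_win] R.
have [|s' s'_resp [rho' R']] := fan_step symG L R _ uv; first by apply: N_big; lia.
have s'1 := responses_size s'_resp.
have [t' t'_win] : exists t', wins d t' s'.
  elim: (responses s u v) ts ts_win s'_resp => [|r rs IHrs] [|t ts] //= /andP[t_win ts_win].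
  rewrite inE => /predU1P[->|]; [by exists t | exact: (IHrs _ ts_win)].
apply: (IHd _ _ _ _ t'_win R') => n; rewrite s'1 => n_le; apply: N_big; lia.
Qed.

(** * Symmetry under exchange of colours *)

Definition transpose (i j k : nat) := if k == i then j else if k == j then i else k.

Definition recolour (f : nat -> nat) (s : state) : state :=
  (s.1, [seq (e.1, f e.2) | e <- s.2]).

(* The root edge has colour 0, so up to exchanging the colours 1 and 2 the first nonzero
   colour is 1. *)
Definition canonical (s : state) : state :=
  if head 0 [seq k <- map snd s.2 | k != 0] == 2 then recolour (transpose 1 2) s
  else s.

Lemma transposeK i j : involutive (transpose i j).
Proof.
move=> k; rewrite /transpose.
have [->|ki] := eqVneq k i; first by have [->|ji] := eqVneq j i; rewrite ?eqxx.
have [->|kj] := eqVneq k j; first by rewrite eqxx.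
by rewrite (negPf ki) (negPf kj).
Qed.

Lemma layout_recolour G pos c i j :
  i < 3 -> j < 3 -> layout G pos c -> layout G pos (fun u v => transpose i j (c u v)).
Proof.
move=> i3 j3 [pos_inj c_sym no_nest]; split=> //.
  move=> u v /c_sym[-> c3]; split=> //.
  by rewrite /transpose; case: eqP => // _; case: eqP.
move=> a b x y ab xy ax xy' yb /(inv_inj (transposeK i j)).
exact: no_nest.
Qed.

Lemma realizes_recolour G N pos c d s rho f :
  realizes G N pos c d s rho ->
  realizes G N pos (fun u v => f (c u v)) d (recolour f s) rho.
Proof.
move=> [rho_mono [rhoG sP]]; split=> //; split=> // e /mapP[e' /sP[? ? ? e_col] ->].
by split=> //=; rewrite e_col.
Qed.

(** * The search tree *)

Definition root : state := (2, [:: (0, 1, 0)]).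

(** The certificate: one entry for each response to the fan over the root edge, up to exchanging the
    colours 1 and 2, in the order of the list in [strategies_win]. *)
Definition strategies : seq strategy := [::
  Fan 2 7 [:: Fan 9 12 [::]; Fan 9 12 [::]; Fan 9 12 [::]];
  Fan 2 7 [:: Fan 9 12 [::]; Fan 9 12 [::]; Fan 9 12 [::]];
  Fan 2 7 [:: Fan 10 11 [::]; Fan 10 11 [::]; Fan 10 11 [::]];
  Fan 1 7 [:: Fan 6 9 [:: Fan 8 19 [::]; Fan 8 19 [::]]; Fan 6 9 [:: Fan 8 19 [::]; Fan 8 19 [::]];
    Fan 6 9 [:: Fan 7 19 [::]; Fan 7 19 [::]]; Fan 6 9 [:: Fan 7 19 [::]; Fan 7 19 [::]; Fan 4 19
    [::]]; Fan 7 10 [:: Fan 7 19 [::]; Fan 7 19 [::]]; Fan 6 9 [:: Fan 7 19 [::]; Fan 7 19 [::]];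
    Fan 1 8 [:: Fan 10 13 [::]; Fan 10 13 [::]; Fan 10 13 [::]; Fan 8 15 [::]; Fan 8 15 [::]; Fan 10
    13 [::]]; Fan 8 13 [::]; Fan 1 9 [:: Fan 10 14 [::]; Fan 10 14 [::]; Fan 10 14 [::]; Fan 7 19
    [::]; Fan 7 19 [::]; Fan 10 14 [::]]; Fan 9 13 [::]];
  Fan 1 7 [:: Fan 6 9 [:: Fan 8 19 [::]; Fan 8 19 [::]]; Fan 6 9 [:: Fan 8 19 [::]; Fan 8 19 [::]];
    Fan 6 9 [:: Fan 7 19 [::]; Fan 7 19 [::]]; Fan 6 9 [:: Fan 7 19 [::]; Fan 7 19 [::]; Fan 4 19
    [::]]; Fan 7 10 [:: Fan 7 19 [::]; Fan 7 19 [::]]; Fan 6 9 [:: Fan 7 19 [::]; Fan 7 19 [::]];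
    Fan 8 13 [::]; Fan 1 8 [:: Fan 10 13 [::]; Fan 10 13 [::]; Fan 10 13 [::]; Fan 8 15 [::]; Fan 8
    15 [::]; Fan 10 13 [::]]; Fan 9 13 [::]; Fan 1 9 [:: Fan 10 14 [::]; Fan 10 14 [::]; Fan 10 14
    [::]; Fan 7 19 [::]; Fan 7 19 [::]; Fan 10 14 [::]]];
  Fan 1 7 [:: Fan 6 9 [:: Fan 8 19 [::]; Fan 8 19 [::]]; Fan 6 9 [:: Fan 8 19 [::]; Fan 8 19 [::]];
    Fan 6 9 [:: Fan 7 19 [::]; Fan 7 19 [::]]; Fan 6 9 [:: Fan 7 19 [::]; Fan 7 19 [::]; Fan 4 19
    [::]]; Fan 7 10 [:: Fan 7 19 [::]; Fan 7 19 [::]]; Fan 6 9 [:: Fan 7 19 [::]; Fan 7 19 [::]];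
    Fan 1 8 [:: Fan 10 13 [::]; Fan 10 13 [::]; Fan 10 13 [::]; Fan 8 15 [::]; Fan 8 15 [::]; Fan 10
    13 [::]]; Fan 8 13 [::]; Fan 1 9 [:: Fan 10 14 [::]; Fan 10 14 [::]; Fan 10 14 [::]; Fan 7 19
    [::]; Fan 7 19 [::]; Fan 10 14 [::]]; Fan 9 13 [::]];
  Fan 1 7 [:: Fan 8 11 [::]; Fan 8 11 [::]; Fan 8 11 [::]; Fan 8 11 [::]; Fan 8 11 [::]; Fan 8 11
    [::]; Fan 8 13 [::]; Fan 10 12 [::]; Fan 9 13 [::]; Fan 5 11 [:: Fan 7 19 [::]; Fan 7 19 [::];
    Fan 4 19 [::]]];
  Fan 1 7 [:: Fan 6 9 [:: Fan 8 19 [::]; Fan 8 19 [::]]; Fan 6 9 [:: Fan 8 19 [::]; Fan 8 19 [::]];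
    Fan 6 9 [:: Fan 7 19 [::]; Fan 7 19 [::]]; Fan 7 10 [:: Fan 7 19 [::]; Fan 7 19 [::]]; Fan 6 9
    [:: Fan 7 19 [::]; Fan 7 19 [::]; Fan 4 19 [::]]; Fan 6 9 [:: Fan 7 19 [::]; Fan 7 19 [::]]; Fan
    1 8 [:: Fan 10 13 [::]; Fan 10 13 [::]; Fan 10 13 [::]; Fan 8 15 [::]; Fan 8 15 [::]; Fan 10 13
    [::]]; Fan 8 13 [::]; Fan 1 9 [:: Fan 10 14 [::]; Fan 10 14 [::]; Fan 10 14 [::]; Fan 7 19 [::];
    Fan 7 19 [::]; Fan 10 14 [::]]; Fan 9 13 [::]];
  Fan 1 7 [:: Fan 8 11 [::]; Fan 8 11 [::]; Fan 8 11 [::]; Fan 8 11 [::]; Fan 8 11 [::]; Fan 8 11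
    [::]; Fan 8 13 [::]; Fan 8 13 [::]; Fan 9 13 [::]; Fan 9 13 [::]];
  Fan 1 7 [:: Fan 6 9 [:: Fan 8 19 [::]; Fan 8 19 [::]]; Fan 6 9 [:: Fan 8 19 [::]; Fan 8 19 [::]];
    Fan 6 9 [:: Fan 7 19 [::]; Fan 7 19 [::]]; Fan 7 10 [:: Fan 7 19 [::]; Fan 7 19 [::]]; Fan 6 9
    [:: Fan 7 19 [::]; Fan 7 19 [::]; Fan 4 19 [::]]; Fan 6 9 [:: Fan 7 19 [::]; Fan 7 19 [::]]; Fan
    1 8 [:: Fan 10 13 [::]; Fan 10 13 [::]; Fan 10 13 [::]; Fan 8 15 [::]; Fan 8 15 [::]; Fan 10 13
    [::]]; Fan 8 13 [::]; Fan 1 9 [:: Fan 10 14 [::]; Fan 10 14 [::]; Fan 10 14 [::]; Fan 7 19 [::];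
    Fan 7 19 [::]; Fan 10 14 [::]]; Fan 9 13 [::]];
  Fan 1 7 [:: Fan 8 11 [::]; Fan 8 11 [::]; Fan 8 11 [::]; Fan 8 11 [::]; Fan 8 11 [::]; Fan 8 11
    [::]; Fan 8 13 [::]; Fan 8 13 [::]; Fan 9 13 [::]; Fan 9 13 [::]];
  Fan 1 7 [:: Fan 6 9 [:: Fan 8 19 [::]; Fan 8 19 [::]]; Fan 6 9 [:: Fan 8 19 [::]; Fan 8 19 [::]];
    Fan 6 9 [:: Fan 7 19 [::]; Fan 7 19 [::]]; Fan 7 10 [:: Fan 7 19 [::]; Fan 7 19 [::]]; Fan 6 9
    [:: Fan 7 19 [::]; Fan 7 19 [::]; Fan 4 19 [::]]; Fan 6 9 [:: Fan 7 19 [::]; Fan 7 19 [::]]; Fan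
    8 13 [::]; Fan 1 8 [:: Fan 10 13 [::]; Fan 10 13 [::]; Fan 10 13 [::]; Fan 8 15 [::]; Fan 8 15
    [::]; Fan 10 13 [::]]; Fan 9 13 [::]; Fan 1 9 [:: Fan 10 14 [::]; Fan 10 14 [::]; Fan 10 14
    [::]; Fan 7 19 [::]; Fan 7 19 [::]; Fan 10 14 [::]]];
  Fan 1 7 [:: Fan 6 9 [:: Fan 8 19 [::]; Fan 8 19 [::]]; Fan 6 9 [:: Fan 8 19 [::]; Fan 8 19 [::]];
    Fan 6 9 [:: Fan 7 19 [::]; Fan 7 19 [::]]; Fan 7 10 [:: Fan 7 19 [::]; Fan 7 19 [::]]; Fan 6 9
    [:: Fan 7 19 [::]; Fan 7 19 [::]; Fan 4 19 [::]]; Fan 6 9 [:: Fan 7 19 [::]; Fan 7 19 [::]]; Fan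
    1 8 [:: Fan 10 13 [::]; Fan 10 13 [::]; Fan 10 13 [::]; Fan 8 15 [::]; Fan 8 15 [::]; Fan 10 13
    [::]]; Fan 8 13 [::]; Fan 1 9 [:: Fan 10 14 [::]; Fan 10 14 [::]; Fan 10 14 [::]; Fan 7 19 [::];
    Fan 7 19 [::]; Fan 10 14 [::]]; Fan 9 13 [::]];
  Fan 1 7 [:: Fan 6 9 [:: Fan 8 19 [::]; Fan 8 19 [::]]; Fan 6 9 [:: Fan 8 19 [::]; Fan 8 19 [::]];
    Fan 6 9 [:: Fan 7 19 [::]; Fan 7 19 [::]]; Fan 7 10 [:: Fan 7 19 [::]; Fan 7 19 [::]]; Fan 6 9
    [:: Fan 7 19 [::]; Fan 7 19 [::]; Fan 4 19 [::]]; Fan 6 9 [:: Fan 7 19 [::]; Fan 7 19 [::]]; Fan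
    1 8 [:: Fan 10 13 [::]; Fan 10 13 [::]; Fan 10 13 [::]; Fan 8 15 [::]; Fan 8 15 [::]; Fan 10 13
    [::]]; Fan 8 13 [::]; Fan 1 9 [:: Fan 10 14 [::]; Fan 10 14 [::]; Fan 10 14 [::]; Fan 7 19 [::];
    Fan 7 19 [::]; Fan 10 14 [::]]; Fan 9 13 [::]];
  Fan 1 7 [:: Fan 8 11 [::]; Fan 8 11 [::]; Fan 8 11 [::]; Fan 8 11 [::]; Fan 8 11 [::]; Fan 8 11
    [::]; Fan 8 13 [::]; Fan 10 12 [::]; Fan 9 13 [::]; Fan 5 11 [:: Fan 7 19 [::]; Fan 7 19 [::];
    Fan 4 19 [::]]];
  Fan 1 5 [:: Fan 6 10 [:: Fan 6 17 [::]; Fan 6 17 [::]]; Fan 6 10 [:: Fan 6 17 [::]; Fan 6 17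
    [::]]; Fan 6 10 [:: Fan 7 17 [::]; Fan 7 17 [::]]; Fan 7 13 [::]; Fan 7 13 [::]; Fan 6 10 [::
    Fan 7 17 [::]; Fan 7 17 [::]]];
  Fan 1 5 [:: Fan 6 10 [:: Fan 6 17 [::]; Fan 6 17 [::]]; Fan 6 10 [:: Fan 6 17 [::]; Fan 6 17
    [::]]; Fan 6 10 [:: Fan 7 17 [::]; Fan 7 17 [::]]; Fan 7 13 [::]; Fan 7 13 [::]; Fan 6 10 [::
    Fan 7 17 [::]; Fan 7 17 [::]]];
  Fan 1 5 [:: Fan 6 10 [:: Fan 6 17 [::]; Fan 6 17 [::]]; Fan 6 10 [:: Fan 6 17 [::]; Fan 6 17
    [::]]; Fan 6 10 [:: Fan 7 17 [::]; Fan 7 17 [::]]; Fan 7 13 [::]; Fan 7 13 [::]; Fan 6 10 [::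
    Fan 7 17 [::]; Fan 7 17 [::]]];
  Fan 1 5 [:: Fan 2 11 [:: Fan 10 11 [::]; Fan 10 11 [::]; Fan 10 11 [::]]; Fan 2 11 [:: Fan 10 11
    [::]; Fan 10 11 [::]; Fan 10 11 [::]]; Fan 7 13 [:: Fan 8 19 [::]; Fan 7 19 [::]; Fan 7 19
    [::]]; Fan 7 13 [::]; Fan 7 13 [::]; Fan 7 13 [:: Fan 8 19 [::]; Fan 7 19 [::]; Fan 7 19 [::]]];
  Fan 1 7 [:: Fan 8 12 [::]; Fan 8 12 [::]; Fan 8 12 [::]; Fan 8 12 [::]; Fan 8 12 [::]; Fan 8 12
    [::]];
  Fan 1 5 [:: Fan 2 11 [:: Fan 10 11 [::]; Fan 10 11 [::]; Fan 10 11 [::]]; Fan 2 11 [:: Fan 10 11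
    [::]; Fan 10 11 [::]; Fan 10 11 [::]]; Fan 7 13 [:: Fan 8 19 [::]; Fan 7 19 [::]; Fan 7 19
    [::]]; Fan 7 13 [::]; Fan 7 13 [::]; Fan 7 13 [:: Fan 8 19 [::]; Fan 7 19 [::]; Fan 7 19 [::]]];
  Fan 1 5 [:: Fan 2 11 [:: Fan 10 11 [::]; Fan 10 11 [::]; Fan 10 11 [::]]; Fan 2 11 [:: Fan 10 11
    [::]; Fan 10 11 [::]; Fan 10 11 [::]]; Fan 7 13 [:: Fan 8 19 [::]; Fan 7 19 [::]; Fan 7 19
    [::]]; Fan 7 13 [::]; Fan 7 13 [::]; Fan 7 13 [:: Fan 8 19 [::]; Fan 7 19 [::]; Fan 7 19 [::]]];
  Fan 1 7 [:: Fan 8 12 [::]; Fan 8 12 [::]; Fan 8 12 [::]; Fan 8 12 [::]; Fan 8 12 [::]; Fan 8 12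
    [::]];
  Fan 1 5 [:: Fan 2 11 [:: Fan 10 11 [::]; Fan 10 11 [::]; Fan 10 11 [::]]; Fan 2 11 [:: Fan 10 11
    [::]; Fan 10 11 [::]; Fan 10 11 [::]]; Fan 7 13 [:: Fan 6 19 [::]; Fan 6 19 [::]; Fan 6 19
    [::]]; Fan 7 13 [::]; Fan 7 13 [::]; Fan 7 13 [:: Fan 6 19 [::]; Fan 6 19 [::]; Fan 6 19 [::]]];
  Fan 1 6 [::];
  Fan 1 6 [::];
  Fan 1 6 [::];
  Fan 1 6 [::];
  Fan 3 4 [:: Fan 4 5 [::]; Fan 4 7 [::]; Fan 4 7 [::]; Fan 4 7 [::]; Fan 4 7 [::]];
  Fan 3 4 [::];
  Fan 3 4 [::];
  Fan 3 4 [::];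
  Fan 3 4 [::];
  Fan 3 4 [::];
  Fan 3 4 [::];
  Fan 3 4 [::];
  Fan 3 4 [::];
  Fan 3 4 [::];
  Fan 3 4 [::];
  Fan 3 4 [::];
  Fan 3 4 [::];
  Fan 3 4 [::];
  Fan 3 4 [::];
  Fan 3 4 [::];
  Fan 2 5 [:: Fan 4 11 [:: Fan 11 14 [::]; Fan 11 14 [::]]; Fan 4 11 [:: Fan 11 14 [::]; Fan 11 14
    [::]; Fan 11 14 [::]; Fan 11 14 [::]]; Fan 5 11 [:: Fan 12 14 [::]; Fan 12 14 [::]; Fan 12 14
    [::]; Fan 12 14 [::]]; Fan 3 8 [::]; Fan 2 8 [:: Fan 5 7 [::]; Fan 5 7 [::]; Fan 5 7 [::]; Fan 5
    7 [::]]; Fan 2 9 [:: Fan 5 8 [::]; Fan 5 8 [::]]; Fan 2 9 [:: Fan 5 8 [::]; Fan 5 8 [::]; Fan 5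
    8 [::]; Fan 5 8 [::]]];
  Fan 2 5 [:: Fan 4 11 [:: Fan 11 14 [::]; Fan 11 14 [::]]; Fan 7 10 [:: Fan 6 17 [::]; Fan 6 17
    [::]]; Fan 7 10 [:: Fan 6 17 [::]; Fan 6 17 [::]]];
  Fan 2 5 [:: Fan 4 11 [:: Fan 11 14 [::]; Fan 11 14 [::]]; Fan 4 11 [:: Fan 11 14 [::]; Fan 11 14
    [::]; Fan 11 14 [::]; Fan 11 14 [::]]; Fan 5 11 [:: Fan 12 14 [::]; Fan 12 14 [::]; Fan 12 14
    [::]; Fan 12 14 [::]]; Fan 3 8 [::]; Fan 2 9 [:: Fan 5 8 [::]; Fan 5 8 [::]]; Fan 2 9 [:: Fan 5
    8 [::]; Fan 5 8 [::]; Fan 5 8 [::]; Fan 5 8 [::]]];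
  Fan 2 5 [:: Fan 3 6 [:: Fan 2 7 [::]; Fan 2 7 [::]]; Fan 2 8 [:: Fan 3 6 [::]; Fan 3 6 [::]]; Fan
    3 6 [:: Fan 2 8 [::]; Fan 2 8 [::]]];
  Fan 2 5 [:: Fan 2 8 [:: Fan 3 6 [::]; Fan 3 6 [::]]; Fan 3 6 [:: Fan 2 8 [::]; Fan 2 8 [::]]];
  Fan 2 5 [::];
  Fan 2 5 [:: Fan 4 11 [:: Fan 11 14 [::]; Fan 11 14 [::]]; Fan 7 10 [:: Fan 6 17 [::]; Fan 6 17
    [::]]; Fan 7 10 [:: Fan 6 17 [::]; Fan 6 17 [::]]];
  Fan 2 5 [:: Fan 4 11 [:: Fan 11 14 [::]; Fan 11 14 [::]]; Fan 4 11 [:: Fan 11 14 [::]; Fan 11 14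
    [::]; Fan 11 14 [::]; Fan 11 14 [::]]; Fan 1 11 [:: Fan 8 12 [::]; Fan 8 12 [::]; Fan 8 12 [::];
    Fan 8 12 [::]; Fan 8 12 [::]; Fan 8 12 [::]; Fan 11 14 [::]; Fan 12 14 [::]]; Fan 2 10 [:: Fan 8
    9 [::]; Fan 8 9 [::]; Fan 8 9 [::]]; Fan 2 11 [:: Fan 2 9 [::]; Fan 2 9 [::]; Fan 2 9 [::]; Fan
    5 9 [::]; Fan 2 9 [::]; Fan 5 9 [::]; Fan 2 9 [::]; Fan 5 9 [::]]];
  Fan 2 5 [:: Fan 4 11 [:: Fan 11 14 [::]; Fan 11 14 [::]]; Fan 4 11 [:: Fan 11 14 [::]; Fan 11 14
    [::]; Fan 11 14 [::]; Fan 11 14 [::]]; Fan 1 11 [:: Fan 8 12 [::]; Fan 8 12 [::]; Fan 8 12 [::];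
    Fan 8 12 [::]; Fan 8 12 [::]; Fan 8 12 [::]; Fan 11 14 [::]; Fan 12 14 [::]]; Fan 2 10 [:: Fan 8
    9 [::]; Fan 8 9 [::]; Fan 8 9 [::]]; Fan 2 11 [:: Fan 2 9 [::]; Fan 2 9 [::]; Fan 5 9 [::]; Fan
    2 9 [::]; Fan 5 9 [::]; Fan 2 9 [::]; Fan 5 9 [::]; Fan 2 9 [::]]];
  Fan 2 5 [::];
  Fan 2 5 [:: Fan 2 9 [:: Fan 5 8 [::]; Fan 5 8 [::]]; Fan 0 5 [:: Fan 0 10 [::]; Fan 0 9 [::]]];
  Fan 2 5 [:: Fan 2 9 [:: Fan 5 8 [::]; Fan 5 8 [::]]; Fan 3 6 [:: Fan 1 11 [::]; Fan 2 8 [::]; Fan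
    2 8 [::]]];
  Fan 2 5 [:: Fan 3 6 [:: Fan 2 7 [::]; Fan 2 7 [::]]; Fan 2 8 [:: Fan 3 6 [::]; Fan 3 6 [::]]; Fan
    3 6 [:: Fan 2 8 [::]; Fan 2 8 [::]]];
  Fan 2 5 [:: Fan 4 11 [:: Fan 11 14 [::]; Fan 11 14 [::]]; Fan 4 11 [:: Fan 11 14 [::]; Fan 11 14
    [::]; Fan 11 14 [::]; Fan 11 14 [::]]; Fan 3 8 [::]; Fan 2 8 [:: Fan 5 7 [::]; Fan 5 7 [::]; Fan
    5 7 [::]; Fan 5 7 [::]]; Fan 2 9 [:: Fan 5 8 [::]; Fan 5 8 [::]]; Fan 2 9 [:: Fan 5 8 [::]; Fan
    5 8 [::]; Fan 5 8 [::]; Fan 5 8 [::]]];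
  Fan 2 5 [:: Fan 2 9 [:: Fan 5 8 [::]; Fan 5 8 [::]]; Fan 3 6 [:: Fan 2 9 [::]; Fan 2 9 [::]]];
  Fan 2 5 [:: Fan 4 11 [:: Fan 11 14 [::]; Fan 11 14 [::]]; Fan 7 10 [:: Fan 6 17 [::]; Fan 6 17
    [::]]];
  Fan 2 5 [::];
  Fan 2 5 [:: Fan 4 11 [:: Fan 11 14 [::]; Fan 11 14 [::]]; Fan 4 11 [:: Fan 11 14 [::]; Fan 11 14
    [::]; Fan 11 14 [::]; Fan 11 14 [::]]; Fan 3 8 [::]; Fan 2 9 [:: Fan 5 8 [::]; Fan 5 8 [::]];
    Fan 2 9 [:: Fan 5 8 [::]; Fan 5 8 [::]; Fan 5 8 [::]; Fan 5 8 [::]]];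
  Fan 2 5 [:: Fan 2 11 [:: Fan 10 11 [::]; Fan 10 11 [::]; Fan 10 11 [::]]; Fan 1 11 [:: Fan 8 11
    [::]; Fan 8 11 [::]; Fan 8 11 [::]; Fan 8 11 [::]; Fan 8 11 [::]; Fan 8 11 [::]; Fan 8 17 [::];
    Fan 9 17 [::]]; Fan 5 7 [:: Fan 2 14 [::]; Fan 2 14 [::]; Fan 2 11 [::]; Fan 2 15 [::]; Fan 2 11
    [::]; Fan 2 12 [::]; Fan 2 11 [::]; Fan 2 12 [::]]; Fan 2 9 [:: Fan 5 8 [::]; Fan 5 8 [::]]; Fan
    2 9 [:: Fan 5 8 [::]; Fan 5 8 [::]; Fan 5 8 [::]; Fan 5 8 [::]]];
  Fan 2 5 [:: Fan 2 11 [:: Fan 10 11 [::]; Fan 10 11 [::]; Fan 10 11 [::]]; Fan 7 10 [:: Fan 6 17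
    [::]; Fan 6 17 [::]; Fan 7 17 [::]]];
  Fan 2 5 [:: Fan 4 11 [:: Fan 11 14 [::]; Fan 11 14 [::]]; Fan 4 11 [:: Fan 11 14 [::]; Fan 11 14
    [::]; Fan 11 14 [::]; Fan 11 14 [::]]; Fan 2 9 [:: Fan 5 8 [::]; Fan 5 8 [::]]; Fan 2 9 [:: Fan
    5 8 [::]; Fan 5 8 [::]; Fan 5 8 [::]; Fan 5 8 [::]]];
  Fan 2 5 [:: Fan 2 11 [:: Fan 10 11 [::]; Fan 10 11 [::]; Fan 10 11 [::]]; Fan 1 11 [:: Fan 8 11
    [::]; Fan 8 11 [::]; Fan 8 11 [::]; Fan 8 11 [::]; Fan 8 11 [::]; Fan 8 11 [::]; Fan 8 17 [::];
    Fan 9 17 [::]]; Fan 5 7 [:: Fan 2 14 [::]; Fan 2 14 [::]; Fan 2 11 [::]; Fan 2 15 [::]; Fan 2 11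
    [::]; Fan 2 12 [::]; Fan 2 11 [::]; Fan 2 12 [::]]; Fan 2 9 [:: Fan 5 8 [::]; Fan 5 8 [::]]; Fan
    2 9 [:: Fan 5 8 [::]; Fan 5 8 [::]; Fan 5 8 [::]; Fan 5 8 [::]]];
  Fan 2 5 [:: Fan 4 11 [:: Fan 11 14 [::]; Fan 11 14 [::]]; Fan 4 11 [:: Fan 11 14 [::]; Fan 11 14
    [::]; Fan 11 14 [::]; Fan 11 14 [::]]; Fan 2 9 [:: Fan 5 8 [::]; Fan 5 8 [::]]; Fan 2 9 [:: Fan
    5 8 [::]; Fan 5 8 [::]; Fan 5 8 [::]; Fan 5 8 [::]]];
  Fan 2 5 [:: Fan 2 11 [:: Fan 10 11 [::]; Fan 10 11 [::]; Fan 10 11 [::]]; Fan 7 10 [:: Fan 6 17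
    [::]; Fan 6 17 [::]; Fan 6 16 [::]]];
  Fan 2 5 [:: Fan 4 11 [:: Fan 11 14 [::]; Fan 11 14 [::]]; Fan 7 10 [:: Fan 6 17 [::]; Fan 6 17
    [::]]];
  Fan 2 5 [:: Fan 4 11 [:: Fan 11 14 [::]; Fan 11 14 [::]]; Fan 4 11 [:: Fan 11 14 [::]; Fan 11 14
    [::]; Fan 11 14 [::]; Fan 11 14 [::]]; Fan 2 9 [:: Fan 5 8 [::]; Fan 5 8 [::]]; Fan 2 9 [:: Fan
    5 8 [::]; Fan 5 8 [::]; Fan 5 8 [::]; Fan 5 8 [::]]];
  Fan 2 5 [:: Fan 4 11 [:: Fan 11 14 [::]; Fan 11 14 [::]]; Fan 4 11 [:: Fan 11 14 [::]; Fan 11 14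
    [::]; Fan 11 14 [::]; Fan 11 14 [::]]; Fan 2 9 [:: Fan 5 8 [::]; Fan 5 8 [::]]; Fan 2 9 [:: Fan
    5 8 [::]; Fan 5 8 [::]; Fan 5 8 [::]; Fan 5 8 [::]]];
  Fan 2 5 [:: Fan 4 11 [:: Fan 11 14 [::]; Fan 11 14 [::]]; Fan 8 13 [:: Fan 8 19 [::]; Fan 7 19
    [::]]];
  Fan 2 5 [:: Fan 4 11 [:: Fan 11 14 [::]; Fan 11 14 [::]]; Fan 4 11 [:: Fan 11 14 [::]; Fan 11 14
    [::]; Fan 11 14 [::]; Fan 11 14 [::]]; Fan 2 9 [:: Fan 5 8 [::]; Fan 5 8 [::]]; Fan 2 9 [:: Fan
    5 8 [::]; Fan 5 8 [::]; Fan 5 8 [::]; Fan 5 8 [::]]];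
  Fan 2 5 [:: Fan 4 11 [:: Fan 11 14 [::]; Fan 11 14 [::]]; Fan 4 11 [:: Fan 11 14 [::]; Fan 11 14
    [::]; Fan 11 14 [::]; Fan 11 14 [::]]; Fan 2 9 [:: Fan 5 8 [::]; Fan 5 8 [::]]; Fan 2 9 [:: Fan
    5 8 [::]; Fan 5 8 [::]; Fan 5 8 [::]; Fan 5 8 [::]]];
  Fan 2 5 [::];
  Fan 2 5 [:: Fan 2 10 [:: Fan 8 9 [::]; Fan 8 9 [::]; Fan 8 9 [::]]; Fan 3 6 [:: Fan 1 11 [::]; Fan
    2 9 [::]; Fan 2 9 [::]]];
  Fan 2 5 [:: Fan 2 10 [:: Fan 8 9 [::]; Fan 8 9 [::]; Fan 8 9 [::]]; Fan 3 6 [:: Fan 1 11 [::]; Fan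
    2 9 [::]; Fan 2 9 [::]]];
  Fan 2 5 [:: Fan 4 11 [:: Fan 11 14 [::]; Fan 11 14 [::]]; Fan 7 10 [:: Fan 6 17 [::]; Fan 6 17
    [::]; Fan 6 16 [::]]];
  Fan 2 5 [:: Fan 4 11 [:: Fan 11 14 [::]; Fan 11 14 [::]]; Fan 4 11 [:: Fan 11 14 [::]; Fan 11 14
    [::]; Fan 11 14 [::]; Fan 11 14 [::]]; Fan 2 9 [:: Fan 5 8 [::]; Fan 5 8 [::]]; Fan 2 9 [:: Fan
    5 8 [::]; Fan 5 8 [::]; Fan 5 8 [::]; Fan 5 8 [::]]];
  Fan 2 5 [:: Fan 4 11 [:: Fan 11 14 [::]; Fan 11 14 [::]]; Fan 4 11 [:: Fan 11 14 [::]; Fan 11 14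
    [::]; Fan 11 14 [::]; Fan 11 14 [::]]; Fan 2 9 [:: Fan 5 8 [::]; Fan 5 8 [::]]; Fan 2 9 [:: Fan
    5 8 [::]; Fan 5 8 [::]; Fan 5 8 [::]; Fan 5 8 [::]]];
  Fan 2 6 [:: Fan 3 7 [:: Fan 2 10 [::]; Fan 2 10 [::]]; Fan 3 7 [:: Fan 2 10 [::]; Fan 2 10 [::]];
    Fan 3 7 [:: Fan 2 12 [::]; Fan 2 12 [::]]; Fan 0 6 [::]; Fan 0 6 [::]; Fan 3 7 [:: Fan 2 12
    [::]; Fan 2 12 [::]]];
  Fan 2 6 [:: Fan 2 10 [:: Fan 8 9 [::]; Fan 8 9 [::]; Fan 8 9 [::]]; Fan 2 10 [:: Fan 8 9 [::]; Fan
    8 9 [::]; Fan 8 9 [::]]; Fan 0 6 [:: Fan 0 10 [::]; Fan 0 12 [::]; Fan 0 12 [::]]; Fan 0 6 [::];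
    Fan 0 6 [::]; Fan 0 6 [:: Fan 0 10 [::]; Fan 0 9 [::]; Fan 0 12 [::]]];
  Fan 2 6 [:: Fan 2 10 [:: Fan 8 9 [::]; Fan 8 9 [::]; Fan 8 9 [::]]; Fan 2 10 [:: Fan 8 9 [::]; Fan
    8 9 [::]; Fan 8 9 [::]]; Fan 0 6 [:: Fan 0 10 [::]; Fan 0 12 [::]; Fan 0 12 [::]]; Fan 0 6 [::];
    Fan 0 6 [::]; Fan 0 6 [:: Fan 0 10 [::]; Fan 0 9 [::]; Fan 0 12 [::]]];
  Fan 2 6 [:: Fan 3 7 [:: Fan 2 10 [::]; Fan 2 10 [::]]; Fan 3 7 [:: Fan 2 10 [::]; Fan 2 10 [::]];
    Fan 3 7 [:: Fan 2 12 [::]; Fan 2 12 [::]]; Fan 0 6 [::]; Fan 0 6 [::]; Fan 3 7 [:: Fan 2 12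
    [::]; Fan 2 12 [::]]];
  Fan 2 6 [:: Fan 3 7 [:: Fan 2 10 [::]; Fan 2 10 [::]]; Fan 3 7 [:: Fan 2 10 [::]; Fan 2 10 [::]];
    Fan 3 7 [:: Fan 2 12 [::]; Fan 2 12 [::]]; Fan 0 6 [::]; Fan 0 6 [::]; Fan 3 7 [:: Fan 2 12
    [::]; Fan 2 12 [::]]];
  Fan 0 6 [:: Fan 1 5 [::]; Fan 1 5 [::]; Fan 1 5 [::]; Fan 1 5 [::]; Fan 1 5 [::]; Fan 1 5 [::]];
  Fan 0 6 [:: Fan 1 5 [::]; Fan 1 5 [::]; Fan 1 5 [::]; Fan 1 5 [::]; Fan 1 5 [::]; Fan 1 5 [::]];
  Fan 2 6 [:: Fan 2 10 [:: Fan 8 9 [::]; Fan 8 9 [::]; Fan 8 9 [::]]; Fan 2 10 [:: Fan 8 9 [::]; Fan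
    8 9 [::]; Fan 8 9 [::]]; Fan 0 6 [:: Fan 0 10 [::]; Fan 0 12 [::]; Fan 0 12 [::]]; Fan 0 6 [::];
    Fan 0 6 [::]; Fan 0 6 [:: Fan 0 10 [::]; Fan 0 9 [::]; Fan 0 12 [::]]];
  Fan 2 6 [:: Fan 2 10 [:: Fan 8 9 [::]; Fan 8 9 [::]; Fan 8 9 [::]]; Fan 2 10 [:: Fan 8 9 [::]; Fan
    8 9 [::]; Fan 8 9 [::]]; Fan 0 6 [:: Fan 0 10 [::]; Fan 0 12 [::]; Fan 0 12 [::]]; Fan 0 6 [::];
    Fan 0 6 [::]; Fan 0 6 [:: Fan 0 10 [::]; Fan 0 9 [::]; Fan 0 12 [::]]];
  Fan 0 5 [:: Fan 1 4 [::]; Fan 1 4 [::]; Fan 1 4 [::]];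
  Fan 0 5 [:: Fan 1 4 [::]; Fan 1 4 [::]; Fan 1 4 [::]];
  Fan 0 4 [:: Fan 2 3 [::]; Fan 2 3 [::]; Fan 2 3 [::]];
  Fan 0 6 [:: Fan 4 12 [:: Fan 5 9 [::]; Fan 5 9 [::]; Fan 5 9 [::]; Fan 5 9 [::]; Fan 5 9 [::]; Fan
    5 9 [::]]; Fan 0 4 [::]; Fan 4 11 [:: Fan 5 9 [::]; Fan 5 9 [::]; Fan 5 9 [::]; Fan 5 9 [::];
    Fan 5 9 [::]; Fan 5 9 [::]]; Fan 0 5 [::]; Fan 3 6 [:: Fan 0 10 [::]; Fan 0 10 [::]]; Fan 3 6
    [:: Fan 0 10 [::]; Fan 0 10 [::]]; Fan 4 7 [:: Fan 0 12 [::]; Fan 0 12 [::]]; Fan 3 6 [:: Fan 0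
    9 [::]; Fan 0 12 [::]; Fan 0 12 [::]]; Fan 3 6 [:: Fan 0 9 [::]; Fan 0 9 [::]]; Fan 3 6 [:: Fan
    0 12 [::]; Fan 0 12 [::]]];
  Fan 0 6 [:: Fan 4 12 [:: Fan 5 9 [::]; Fan 5 9 [::]; Fan 5 9 [::]; Fan 5 9 [::]; Fan 5 9 [::]; Fan
    5 9 [::]]; Fan 0 4 [::]; Fan 4 11 [:: Fan 5 9 [::]; Fan 5 9 [::]; Fan 5 9 [::]; Fan 5 9 [::];
    Fan 5 9 [::]; Fan 5 9 [::]]; Fan 0 5 [::]; Fan 3 6 [:: Fan 0 10 [::]; Fan 0 10 [::]]; Fan 3 6
    [:: Fan 0 10 [::]; Fan 0 10 [::]]; Fan 4 7 [:: Fan 0 12 [::]; Fan 0 12 [::]]; Fan 3 6 [:: Fan 0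
    15 [::]; Fan 0 12 [::]; Fan 0 12 [::]]; Fan 3 6 [:: Fan 0 9 [::]; Fan 0 9 [::]]; Fan 3 6 [:: Fan
    0 12 [::]; Fan 0 12 [::]]];
  Fan 0 6 [:: Fan 4 12 [:: Fan 5 9 [::]; Fan 5 9 [::]; Fan 5 9 [::]; Fan 5 9 [::]; Fan 5 9 [::]; Fan
    5 9 [::]]; Fan 0 4 [::]; Fan 4 11 [:: Fan 5 9 [::]; Fan 5 9 [::]; Fan 5 9 [::]; Fan 5 9 [::];
    Fan 5 9 [::]; Fan 5 9 [::]]; Fan 0 5 [::]; Fan 3 6 [:: Fan 0 10 [::]; Fan 0 10 [::]]; Fan 3 6
    [:: Fan 0 10 [::]; Fan 0 10 [::]]; Fan 3 6 [:: Fan 0 12 [::]; Fan 0 12 [::]]; Fan 3 6 [:: Fan 0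
    9 [::]; Fan 0 9 [::]]; Fan 3 6 [:: Fan 0 9 [::]; Fan 0 12 [::]; Fan 0 12 [::]]; Fan 4 7 [:: Fan
    0 12 [::]; Fan 0 12 [::]]];
  Fan 0 6 [:: Fan 4 12 [:: Fan 5 9 [::]; Fan 5 9 [::]; Fan 5 9 [::]; Fan 5 9 [::]; Fan 5 9 [::]; Fan
    5 9 [::]]; Fan 0 4 [::]; Fan 4 11 [:: Fan 5 9 [::]; Fan 5 9 [::]; Fan 5 9 [::]; Fan 5 9 [::];
    Fan 5 9 [::]; Fan 5 9 [::]]; Fan 0 5 [::]; Fan 3 6 [:: Fan 0 10 [::]; Fan 0 10 [::]]; Fan 3 6
    [:: Fan 0 10 [::]; Fan 0 10 [::]]; Fan 4 7 [:: Fan 0 12 [::]; Fan 0 12 [::]]; Fan 3 6 [:: Fan 0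
    9 [::]; Fan 0 12 [::]; Fan 0 12 [::]]; Fan 3 6 [:: Fan 0 9 [::]; Fan 0 9 [::]]; Fan 3 6 [:: Fan
    0 12 [::]; Fan 0 12 [::]]];
  Fan 0 6 [:: Fan 4 12 [:: Fan 5 9 [::]; Fan 5 9 [::]; Fan 5 9 [::]; Fan 5 9 [::]; Fan 5 9 [::]; Fan
    5 9 [::]]; Fan 0 4 [::]; Fan 4 11 [:: Fan 5 9 [::]; Fan 5 9 [::]; Fan 5 9 [::]; Fan 5 9 [::];
    Fan 5 9 [::]; Fan 5 9 [::]]; Fan 0 5 [::]; Fan 3 6 [:: Fan 0 10 [::]; Fan 0 10 [::]]; Fan 3 6
    [:: Fan 0 10 [::]; Fan 0 10 [::]]; Fan 3 6 [:: Fan 0 12 [::]; Fan 0 12 [::]]; Fan 3 6 [:: Fan 0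
    9 [::]; Fan 0 9 [::]]; Fan 3 6 [:: Fan 0 9 [::]; Fan 0 12 [::]; Fan 0 12 [::]]; Fan 4 7 [:: Fan
    0 12 [::]; Fan 0 12 [::]]];
  Fan 0 6 [:: Fan 4 12 [:: Fan 5 9 [::]; Fan 5 9 [::]; Fan 5 9 [::]; Fan 5 9 [::]; Fan 5 9 [::]; Fan
    5 9 [::]]; Fan 0 4 [::]; Fan 4 11 [:: Fan 5 9 [::]; Fan 5 9 [::]; Fan 5 9 [::]; Fan 5 9 [::];
    Fan 5 9 [::]; Fan 5 9 [::]]; Fan 0 5 [::]; Fan 3 6 [:: Fan 0 10 [::]; Fan 0 10 [::]]; Fan 3 6
    [:: Fan 0 10 [::]; Fan 0 10 [::]]; Fan 4 7 [:: Fan 0 12 [::]; Fan 0 12 [::]]; Fan 3 6 [:: Fan 0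
    9 [::]; Fan 0 12 [::]; Fan 0 12 [::]]; Fan 3 6 [:: Fan 0 9 [::]; Fan 0 9 [::]]; Fan 3 6 [:: Fan
    0 12 [::]; Fan 0 12 [::]]];
  Fan 0 6 [:: Fan 0 4 [::]; Fan 4 12 [:: Fan 5 9 [::]; Fan 5 9 [::]; Fan 5 9 [::]; Fan 5 9 [::]; Fan
    5 9 [::]; Fan 5 9 [::]]; Fan 0 5 [::]; Fan 4 11 [:: Fan 5 9 [::]; Fan 5 9 [::]; Fan 5 9 [::];
    Fan 5 9 [::]; Fan 5 9 [::]; Fan 5 9 [::]]; Fan 3 6 [:: Fan 0 10 [::]; Fan 0 10 [::]]; Fan 3 6
    [:: Fan 0 10 [::]; Fan 0 10 [::]]; Fan 3 6 [:: Fan 0 12 [::]; Fan 0 12 [::]]; Fan 3 6 [:: Fan 0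
    9 [::]; Fan 0 9 [::]]; Fan 3 6 [:: Fan 0 15 [::]; Fan 0 12 [::]; Fan 0 12 [::]]; Fan 4 7 [:: Fan
    0 12 [::]; Fan 0 12 [::]]];
  Fan 0 6 [:: Fan 4 12 [:: Fan 5 9 [::]; Fan 5 9 [::]; Fan 5 9 [::]; Fan 5 9 [::]; Fan 5 9 [::]; Fan
    5 9 [::]]; Fan 0 4 [::]; Fan 4 11 [:: Fan 5 9 [::]; Fan 5 9 [::]; Fan 5 9 [::]; Fan 5 9 [::];
    Fan 5 9 [::]; Fan 5 9 [::]]; Fan 0 5 [::]; Fan 3 6 [:: Fan 0 10 [::]; Fan 0 10 [::]]; Fan 3 6
    [:: Fan 0 10 [::]; Fan 0 10 [::]]; Fan 4 7 [:: Fan 0 12 [::]; Fan 0 12 [::]]; Fan 3 6 [:: Fan 0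
    9 [::]; Fan 0 12 [::]; Fan 0 12 [::]]; Fan 3 6 [:: Fan 0 9 [::]; Fan 0 9 [::]]; Fan 3 6 [:: Fan
    0 12 [::]; Fan 0 12 [::]]];
  Fan 0 6 [:: Fan 0 4 [::]; Fan 0 4 [::]; Fan 0 4 [::]; Fan 0 4 [::]; Fan 2 5 [::]; Fan 2 5 [::];
    Fan 2 5 [::]; Fan 2 5 [::]; Fan 2 5 [::]; Fan 2 5 [::]];
  Fan 0 6 [:: Fan 0 4 [::]; Fan 0 4 [::]; Fan 0 4 [::]; Fan 0 4 [::]; Fan 2 5 [::]; Fan 2 5 [::];
    Fan 2 5 [::]; Fan 2 5 [::]; Fan 2 5 [::]; Fan 2 5 [::]];
  Fan 0 6 [:: Fan 0 4 [::]; Fan 2 8 [:: Fan 0 15 [::]; Fan 0 12 [::]; Fan 0 12 [::]]; Fan 0 4 [::];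
    Fan 1 3 [::]; Fan 2 5 [::]; Fan 2 5 [::]; Fan 2 5 [::]; Fan 2 5 [::]; Fan 2 5 [::]; Fan 2 5
    [::]];
  Fan 0 6 [:: Fan 0 4 [::]; Fan 2 8 [:: Fan 0 15 [::]; Fan 0 12 [::]; Fan 0 12 [::]]; Fan 0 4 [::];
    Fan 1 3 [::]; Fan 2 5 [::]; Fan 2 5 [::]; Fan 2 5 [::]; Fan 2 5 [::]; Fan 2 5 [::]; Fan 2 5
    [::]]].

Lemma strategies_win :
  all2 (wins 3) strategies (undup (map canonical (responses root 0 1))).
Proof. by vm_cast_no_check (erefl true). Qed.

(** Depth 4 pays for the fan over the root edge and for the three further fans of [wins 3]. The
    bound 26 is [2 + 6 * 4]. *)
Lemma no_layout G N pos c :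
  symmetric G -> (forall n, n <= 26 -> n + 4 * #|{: fan_type n}| < N) ->
  rich G N 4 0 1 -> layout G pos c -> False.
Proof.
move=> symG N_big rich01 L.
(* The root edge gets colour 0 by exchanging 0 with its actual colour, and its ends are swapped if
   they occur in the wrong order. *)
wlog: pos c L / exists u v, [/\ rich G N 4 u v, pos u < pos v & c u v = 0]
  => [IH|[u [v [rich_uv uv c_uv]]]].
  have G01 := rich_edge rich01; have G10 : G 1 0 by rewrite symG.
  have [pos_inj c_sym _] := L.
  pose c' u v := transpose (c 0 1) 0 (c u v).
  have c01 : c' 0 1 = 0.
    by rewrite /c' /transpose eqxx.
  have c10 : c' 1 0 = 0 by rewrite /c'; have [<- _] := c_sym _ _ G01.
  have L' : layout G pos c' by apply: layout_recolour => //; case: (c_sym _ _ G01).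
  apply: (IH pos c' L'); case: (ltngtP (pos 0) (pos 1)) => [lt|gt|e01].
  - by exists 0, 1.
  - by exists 1, 0; split=> //; apply: rich_sym.
  by have := pos_inj _ _ _ _ G01 G10 e01.
have R : realizes G N pos c 4 root (fun r => if r is 0 then u else v).
  have Guv := rich_edge rich_uv.
  split; first by case=> [|r] [|[|r']].
  split; first by case=> [|[|r]] // _; [exists v | exists u; rewrite symG].
  by move=> e; rewrite inE => /eqP->.
have [|//|s s_resp [rho {}R]] := fan_step symG L R (u := 0) (v := 1).
  exact: N_big.
have s1 : s.1 = 8 := responses_size s_resp.
have [t t_win] : exists t, wins 3 t (canonical s).
  have : canonical s \in undup (map canonical (responses root 0 1)).
    by rewrite mem_undup map_f.
  elim: (undup _) strategies strategies_win => [|r rs IHrs] [|t ts] //= /andP[t_win ts_win].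
  rewrite inE => /predU1P[->|]; [by exists t | exact: (IHrs _ ts_win)].
have s1' : (canonical s).1 = 8 by rewrite /canonical; case: ifP.
have N_big' n : n <= (canonical s).1 + 6 * 3 -> n + 4 * #|{: fan_type n}| < N.
  by rewrite s1'; apply: N_big.
(* If [canonical] exchanged the colours 1 and 2 in the state, the same exchange is applied to the
   layout. *)
move: t_win N_big'; rewrite /canonical; case: ifP => _ t_win N_big'.
  have L' := @layout_recolour G pos c 1 2 isT isT L.
  exact: (wins_sound symG L' N_big' t_win (realizes_recolour _ R)).
exact: (wins_sound symG L N_big' t_win R).
Qed.

Theorem mainTheorem2 :
  exists (n : nat) (E : rel nat), is_planar3tree n E /\ queue_number_ge n E 4.
Proof.
(* The number of types depends on the size of the state; the maximum over all sizes up to 26 gives a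
   single fan length. *)
pose N := (\max_(n < 27) (n + 4 * #|{: fan_type n}|)).+1.
have N_big n : n <= 26 -> n + 4 * #|{: fan_type n}| < N.
  move=> n26; rewrite ltnS.
  exact: (leq_bigmax (F := fun n : 'I_27 => n + 4 * #|{: fan_type n}|) (Ordinal (n26 : n < 27))).
have [n [E [F [nEF rich01]]]] := rich_planar3tree N 4.
exists n, E; split; first by exists F.
move=> k [pos [c [pos_inj [c_sym no_nest]]]]; rewrite ltnNge; apply/negP => k3.
have symE := planar3tree_sym nEF.
apply: (no_layout (adjacency_sym nEF) N_big rich01 (pos := pos) (c := c)); split.
- move=> u v x y /and3P[un _ _] /and3P[vn _ _]; exact: pos_inj.
- move=> u v /and3P[un vn Euv]; have [-> ck] := c_sym _ _ un vn Euv.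
  by split=> //; apply: leq_trans ck k3.
move=> a b x y /and3P[an bn Eab] /and3P[xn yn Exy] ax xy yb cE.
apply: (no_nest a b x y) => //; last by rewrite /nested ax xy yb.
(* The four positions are strictly ordered, so the two edges share no endpoint. *)
all: apply/eqP => e; move: ax xy yb; rewrite ?e; lia.
Qed.
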